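(* Let $V$ be a complex vector space of dimension $3$, let $C$ be a quadric of a line $\ell$ of $\mathbb{P}(V)=\mathbb{P}_2$ (so $C$ consists of two distinct points, or is a double point of $\ell$), and let $W_0\subset S^2V^*$ be the space of equations of conics of $\mathbb{P}_2$ containing $C$. Then the fibres of the quotient map $$\mathrm{Cong}(C)/G_C\longrightarrow \mathrm{Isom}(W_0,W_0^* )/GL(W_0)$$ induced by $\Phi_C:\sigma\mapsto(\sigma^* )^{-1}$ are finite.
   Context: A quadratic congruence with values in $\mathbb{P}(W_0)$ is a rational map $\sigma:\mathbb{P}(V)\dashrightarrow\mathbb{P}(W_0)$ such that: (1) $\sigma^*(\mathcal{O}(1))=\mathcal{O}(2)$; (2) $\sigma^*:W_0^*\to H^0(\mathbb{P}(V),\mathcal{O}(2))=S^2V^*$ induces an isomorphism $W_0^*\simeq W_0$, also denoted $\sigma^*$ (determined up to a nonzero scalar); (3) $P\in\sigma(P)$ for every point $P$ where $\sigma$ is defined, $\sigma(P)$ being viewed as a conic of $\mathbb{P}(V)$. $\mathrm{Cong}(C)$ is the set of quadratic congruences with values in $\mathbb{P}(W_0)$ whose associated isomorphism $(\sigma^* )^{-1}$ is not antisymmetric. $G_C\subset GL(V)$ is the subgroup of elements leaving $C$ invariant; it acts on $\mathrm{Cong}(C)$ by $(\alpha.\sigma)(P)=\alpha^{-1}(\sigma(\alpha(P)))$. The group $GL(W_0)$ acts on $\mathrm{Isom}(W_0,W_0^* )$ by $\phi.g={}^tg\circ\phi\circ g$ (so nonzero multiples of $\phi$ lie in the same orbit),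 and $\Phi_C$ is compatible with the natural homomorphism $G_C\to GL(W_0)$. *)

(* Defs.v *)
From HB Require Import structures.
From mathcomp Require Import all_boot all_order all_algebra.
From mathcomp Require Import boolp classical_sets functions cardinality reals.
From mathcomp Require Import complex.

Set Implicit Arguments.
Unset Strict Implicit.
Unset Printing Implicit Defensive.

Import GRing.Theory.
Local Open Scope ring_scope.
Local Open Scope classical_set_scope.

Section Forms.
Variable K : fieldType.

Definition dual (U : vectType K) := 'Hom(U, K^o).

(* A bilinear form on U, seen as a linear map U -> U^*. *)
Definition bil (U : vectType K) := 'Hom(U, dual U).

Definition precomp (U W : vectType K) (g : 'Hom(U, W)) (xi : dual W) : dual U :=
  (xi \o g)%VF.

Lemma precomp_is_linear (U W : vectType K) (g : 'Hom(U, W)) :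
  linear (precomp g).
Proof. by move=> a x y; rewrite /precomp comp_lfunDl comp_lfunZl. Qed.
HB.instance Definition _ (U W : vectType K) (g : 'Hom(U, W)) :=
  GRing.isLinear.Build K (dual W) (dual U) _ (precomp g) (precomp_is_linear g).

Definition tr (U W : vectType K) (g : 'Hom(U, W)) : 'Hom(dual W, dual U) :=
  linfun (precomp g).

(* {}^t g \o b \o g, i.e. the form (u, v) |-> b (g u) (g v). *)
Definition pull (U W : vectType K) (g : 'Hom(U, W)) (b : bil W) : bil U :=
  (tr g \o (b \o g))%VF.

Lemma trE (U W : vectType K) (g : 'Hom(U, W)) xi : tr g xi = (xi \o g)%VF.
Proof. by rewrite /tr lfunE. Qed.

Lemma pullE (U W : vectType K) (g : 'Hom(U, W)) b u v :
  pull g b u v = b (g u) (g v).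
Proof. by rewrite /pull !comp_lfunE trE comp_lfunE. Qed.

Lemma pull_is_linear (U W : vectType K) (g : 'Hom(U, W)) : linear (pull g).
Proof.
move=> a x y; apply/lfunP => u; apply/lfunP => v.
by rewrite pullE !(add_lfunE, scale_lfunE) !pullE.
Qed.
HB.instance Definition _ (U W : vectType K) (g : 'Hom(U, W)) :=
  GRing.isLinear.Build K (bil W) (bil U) _ (pull g) (pull_is_linear g).

Definition flip1 (U : vectType K) (b : bil U) (u v : U) : K^o := b v u.

Lemma flip1_is_linear (U : vectType K) (b : bil U) (u : U) :
  linear (flip1 b u).
Proof.
by move=> a x y; rewrite /flip1 linearD linearZ add_lfunE scale_lfunE.
Qed.
HB.instance Definition _ (U : vectType K) (b : bil U) (u : U) :=
  GRing.isLinear.Build K U K^o _ (flip1 b u) (flip1_is_linear b u).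

Definition flip2 (U : vectType K) (b : bil U) (u : U) : dual U :=
  linfun (flip1 b u).

Lemma flip2_is_linear (U : vectType K) (b : bil U) : linear (flip2 b).
Proof.
move=> a x y; apply/lfunP => v.
by rewrite add_lfunE scale_lfunE !lfunE /= /flip1 linearD linearZ.
Qed.
HB.instance Definition _ (U : vectType K) (b : bil U) :=
  GRing.isLinear.Build K U (dual U) _ (flip2 b) (flip2_is_linear b).

Definition flip (U : vectType K) (b : bil U) : bil U := linfun (flip2 b).

Lemma flipE (U : vectType K) (b : bil U) u v : flip b u v = b v u.
Proof. by rewrite /flip lfunE /= /flip2 lfunE. Qed.

Definition alt_part (U : vectType K) (b : bil U) : bil U := b - flip b.

Lemma alt_part_is_linear (U : vectType K) : linear (@alt_part U).
Proof.
move=> a x y; apply/lfunP => u; apply/lfunP => v.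
rewrite /alt_part !(add_lfunE, opp_lfunE, scale_lfunE, flipE).
by rewrite scalerBr opprD addrACA.
Qed.
HB.instance Definition _ (U : vectType K) :=
  GRing.isLinear.Build K (bil U) (bil U) _ (@alt_part U)
    (@alt_part_is_linear U).

(* S^2 U^*, i.e. the space H^0(P(U), O(2)) of quadratic forms on U, each       *)
(* represented by its polar form: b stands for u |-> b u u.  This models       *)
(* S^2 U^* faithfully when 2 is invertible in K.                               *)
Definition sym2 (U : vectType K) : {vspace bil U} :=
  lker (linfun (@alt_part U)).

Lemma sym2P (U : vectType K) (b : bil U) :
  b \in sym2 U <-> (forall u v, b u v = b v u).
Proof.
rewrite memv_ker lfunE /= /alt_part; split.
  move=> /eqP e u v; apply/eqP; rewrite -subr_eq0; apply/eqP.
  move/lfunP: e => /(_ u) /lfunP /(_ v).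
  by rewrite !(add_lfunE, opp_lfunE, zero_lfunE) flipE.
move=> h; apply/eqP/lfunP => u; apply/lfunP => v.
by rewrite !(add_lfunE, opp_lfunE, zero_lfunE) flipE h subrr.
Qed.

Definition antisymmetric_form (U : vectType K) (b : bil U) : Prop :=
  forall u v, b u v = - b v u.

End Forms.

Section Congruences.
Variable K : fieldType.

(* The points of P(U) are the lines of U. *)
Definition proj (U : vectType K) := {P : {vspace U} | \dim P == 1%N}.

(* Rational maps P(U) --> P(W) are encoded by partial functions on points;     *)
(* None is the value at the points of indeterminacy.                           *)
Definition pmap (U W : vectType K) := proj U -> option (proj W).

Definition proj_map (U W : vectType K) (g : 'Hom(U, W)) : pmap U W :=
  fun P => insub (g @: val P)%VS.

(* The quadratic forms s xi have no common factor of positive degree: neither  *)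
(* a linear form m, nor a quadratic form q.                                    *)
Definition no_common_factor (U W : vectType K)
    (s : 'Hom(dual W, bil U)) : Prop :=
  (forall m : dual U, m != 0 ->
     ~ forall xi, exists n : dual U, forall u, s xi u u = m u * n u) /\
  (forall q : bil U, ~ (limg s <= <[q]>)%VS).

(* sigma is a rational map with sigma^*(O(1)) = O(2), and s is sigma^* :       *)
(* W^* -> H^0(P(U), O(2)).  That is, sigma is given in the lowest terms by the *)
(* quadratic map f : U -> W such that xi (f u) = (s xi)(u) for all xi, and is  *)
(* defined exactly where f does not vanish.                                    *)
Definition pullback (U W : vectType K) (sigma : pmap U W)
    (s : 'Hom(dual W, bil U)) : Prop :=
  [/\ (limg s <= sym2 U)%VS, no_common_factor s &
      forall P Q, sigma P = Some Q <->
        exists u w, [/\ val P = <[u]>%VS, val Q = <[w]>%VS &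
                        forall xi : dual W, xi w = s xi u u]].

Variable V : vectType K.

(* Equations of the conics containing the quadric C of the line P(L) defined   *)
(* by the quadratic form c: those whose restriction to L is a multiple of c.   *)
Definition conics_through (L : {vspace V}) (c : bil (subvs_of L)) :
    {vspace bil V} :=
  (sym2 V :&: linfun (pull (linfun (@vsval _ _ L))) @^-1: <[c]>)%VS.

Lemma conics_throughP (L : {vspace V}) (c : bil (subvs_of L)) (q : bil V) :
  q \in conics_through c <->
  (forall u v, q u v = q v u) /\
  (exists a : K, forall u v : subvs_of L, q (vsval u) (vsval v) = a * c u v).
Proof.
rewrite /conics_through memv_cap -memv_preim lfunE /=; split.
  case/andP => /sym2P qs /vlineP [a qa]; split=> //; exists a => u v.
  move/lfunP: qa => /(_ u) /lfunP /(_ v).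
  by rewrite pullE !scale_lfunE !(lfunE (@vsval _ _ L)) /=.
case=> qs [a qa]; apply/andP; split; first exact/sym2P.
apply/vlineP; exists a; apply/lfunP => u; apply/lfunP => v.
by rewrite pullE !scale_lfunE !(lfunE (@vsval _ _ L)) /= qa.
Qed.

(* Elements of GL(V) leaving C invariant (as a subscheme of P(V)). *)
Definition stabilizer (L : {vspace V}) (c : bil (subvs_of L)) :
    set 'End(V) :=
  [set alpha | [/\ lker alpha == 0%VS, (alpha @: L)%VS = L &
     exists2 a : K, a != 0 &
       pull (linfun (@vsproj _ _ L) \o (alpha \o linfun (@vsval _ _ L)))%VF c
         = a *: c]].

Variable W0 : {vspace bil V}.

(* sigma^* is an isomorphism from W0^* onto W0. *)
Definition pullback_iso (s : 'Hom(dual (subvs_of W0), bil V)) : Prop :=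
  lker s == 0%VS /\ limg s = W0.

(* P \in sigma(P), the conic sigma(P) being {v | q v v = 0} for q in Q. *)
Definition incident (sigma : pmap V (subvs_of W0)) : Prop :=
  forall P Q, sigma P = Some Q ->
  forall v (q : subvs_of W0), v \in val P -> q \in val Q -> vsval q v v = 0.

Definition quadratic_congruence (sigma : pmap V (subvs_of W0)) : Prop :=
  (exists2 s, pullback sigma s & pullback_iso s) /\ incident sigma.

Definition Isom : set (bil (subvs_of W0)) :=
  [set phi | lker phi == 0%VS /\ limg phi = fullv].

(* The representatives of the inverse of sigma^*, which is determined up to a  *)
(* nonzero scalar.                                                             *)
Definition Phi (sigma : pmap V (subvs_of W0)) : set (bil (subvs_of W0)) :=
  [set phi | Isom phi /\
     exists s, [/\ pullback sigma s, pullback_iso s &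
                   forall w, s (phi w) = vsval w]].

Definition Cong : set (pmap V (subvs_of W0)) :=
  [set sigma | quadratic_congruence sigma /\
     (forall phi, Phi sigma phi -> ~ antisymmetric_form phi)].

(* The conic of equation q is sent by alpha^-1 to the conic of equation        *)
(* q \o alpha; this is the action on P(W0) when alpha preserves W0.            *)
Definition conic_act (alpha : 'End(V)) : 'End(subvs_of W0) :=
  (linfun (@vsproj _ _ W0)
     \o (linfun (pull alpha) \o linfun (@vsval _ _ W0)))%VF.

(* P |-> alpha^-1 (sigma (alpha P)) *)
Definition cong_act (alpha : 'End(V)) (sigma : pmap V (subvs_of W0)) :
    pmap V (subvs_of W0) :=
  fun P => obind (proj_map (conic_act alpha)) (obind sigma (proj_map alpha P)).

Definition cong_orbit (G : set 'End(V)) (sigma : pmap V (subvs_of W0)) :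
    set (pmap V (subvs_of W0)) :=
  [set cong_act alpha sigma | alpha in G].

Definition cong_quotient (G : set 'End(V)) :
    set (set (pmap V (subvs_of W0))) :=
  [set cong_orbit G sigma | sigma in Cong].

Definition isom_orbit (phi : bil (subvs_of W0)) : set (bil (subvs_of W0)) :=
  [set pull g phi | g in [set g : 'End(subvs_of W0) | lker g == 0%VS]].

Definition isom_quotient : set (set (bil (subvs_of W0))) :=
  [set isom_orbit phi | phi in Isom].

(* Fibre over the class o of the map of quotients induced by Phi: the classes  *)
(* of the congruences sigma such that some representative of Phi(sigma) is in  *)
(* o.  No choice of sigma or of the representative is fixed, hence this does   *)
(* not rely on the map being well defined.                                     *)
Definition fibre (G : set 'End(V)) (o : set (bil (subvs_of W0))) :
    set (set (pmap V (subvs_of W0))) :=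
  [set O | cong_quotient G O /\
     exists2 sigma, O sigma & exists2 phi, Phi sigma phi & o phi].

End Congruences.

Arguments Isom {K V} W0 _.
Arguments isom_quotient {K V} W0 _.
Arguments fibre {K V} W0 G o _.

(* Main.v *)
From HB Require Import structures.
Require Import Defs.
From mathcomp Require Import all_boot all_order all_algebra.
From mathcomp Require Import boolp classical_sets functions cardinality reals.
From mathcomp Require Import complex ring.

Set Implicit Arguments.
Unset Strict Implicit.
Unset Printing Implicit Defensive.

Import GRing.Theory Num.Theory.
Local Open Scope ring_scope.
Local Open Scope classical_set_scope.

(* Choose coordinates with L = {z = 0} and c = x y or c = x^2 on L, so that W0
   has the basis z^2, xz, yz, xy (resp. x^2).  A congruence is the quadratic map
   u |-> sum_ij B_ij X_j(u) X_i of a 4 x 4 matrix B, the matrix of sigma^*, and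
   the condition P in sigma(P) says that the symmetric part of B is a multiple
   lambda Q of the unique quadratic relation Q between the X_i, namely
   X1 X2 - X0 X3 (resp. X1^2 - X0 X3).  As B is not antisymmetric, one may take
   lambda = 1, so B = Q + A with A antisymmetric.  The GL(W0)-class of B determines
   the polynomial det (B + t B^T) up to a scalar, which bounds the Pfaffian of A and
   one more invariant to finitely many values (up to scale when c = x^2).  The
   triangular elements x -> b x + e z, y -> d y + f x + g z, z -> z of G_C bring the
   A with given invariants to finitely many normal forms. *)

(** * Quadratic maps and the action of the stabilizer *)

Section QuadraticMaps.
Variables (K : fieldType) (U W : vectType K).

(** A partial map is handled through a lift [f] to vectors; as [val Q] is a line, [f u] is nonzero
    wherever [sigma] is defined. *)
Definition induced_by (sigma : Defs.pmap U W) (f : U -> W) : Prop :=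
  forall P Q, sigma P = Some Q <->
    exists u, val P = <[u]>%VS /\ val Q = <[f u]>%VS.

Lemma induced_by_inj (sigma tau : Defs.pmap U W) f :
  induced_by sigma f -> induced_by tau f -> sigma = tau.
Proof.
move=> hs ht; apply/funext => P.
case E: (sigma P) => [Q|]; first by apply/esym/ht/hs.
by case E': (tau P) => [Q|//]; move/ht/hs: E'; rewrite E.
Qed.

Lemma eq_induced_by (sigma : Defs.pmap U W) f f' (k : K) :
  k != 0 -> (forall u, f u = k *: f' u) ->
  induced_by sigma f -> induced_by sigma f'.
Proof.
move=> k0 e hs P Q; rewrite hs.
have lineZ w : <[k *: w]>%VS = <[w]>%VS.
  apply/eqP; rewrite eqEsubv -!memvE memvZ ?memv_line //=.
  by rewrite -[X in X \in _](scalerK k0) memvZ ?memv_line.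
by split=> -[u [hP hQ]]; exists u; split=> //; rewrite hQ e lineZ.
Qed.

Lemma proj_mapP (U' W' : vectType K) (g : 'Hom(U', W')) (P : proj U')
    (Q : proj W') :
  proj_map g P = Some Q <-> (g @: val P)%VS = val Q.
Proof.
rewrite /proj_map; split=> [|->]; last by rewrite valK.
by case: insubP => [Q' _ e [<-]|].
Qed.

End QuadraticMaps.

Lemma comp_linfunE (K : fieldType) (A B C D : vectType K) (f : {linear A -> B})
    (g : {linear B -> C}) (h : {linear C -> D}) x :
  (linfun h \o (linfun g \o linfun f))%VF x = h (g (f x)).
Proof. by rewrite !comp_lfunE !lfunE. Qed.

Section CongruenceAction.
Variables (K : fieldType) (V : vectType K) (W0 : {vspace bil V}).
Local Notation W := (subvs_of W0).

(** The second clause makes the projection onto [W0] in [conic_act] harmless; the first makes the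
    action injective. *)
Definition preserves (alpha : 'End(V)) : Prop :=
  lker alpha == 0%VS /\ {in W0, forall q, pull alpha q \in W0}.

Lemma val_conic_act alpha (q : W) :
  preserves alpha -> val (conic_act W0 alpha q) = pull alpha (val q).
Proof.
case=> _ h.
have e : conic_act W0 alpha q = vsproj W0 (pull alpha (vsval q)).
  exact: comp_linfunE.
exact: etrans (congr1 (@vsval _ _ W0) e) (vsprojK (h _ (subvsP q))).
Qed.

Lemma conic_act_inj alpha : preserves alpha -> lker (conic_act W0 alpha) == 0%VS.
Proof.
move=> ha; apply/lker0P => q q' /(congr1 val); rewrite !val_conic_act // => e.
have [a0 _] := ha; apply/val_inj/lfunP => u; apply/lfunP => v.
move/lfunP: e => /(_ (alpha^-1%VF u)) /lfunP /(_ (alpha^-1%VF v)).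
by rewrite !pullE !lker0_lfunVK.
Qed.

Lemma conic_act_comp alpha beta :
  preserves alpha -> preserves beta ->
  forall q, conic_act W0 (alpha \o beta)%VF q
    = conic_act W0 beta (conic_act W0 alpha q).
Proof.
move=> ha hb q; apply/val_inj; rewrite !val_conic_act //.
  by apply/lfunP => u; apply/lfunP => v; rewrite !pullE !comp_lfunE.
split.
  apply/lker0P => u v; rewrite !comp_lfunE.
  by move/(lker0P (proj1 ha))/(lker0P (proj1 hb)).
move=> q' hq'; have -> : pull (alpha \o beta)%VF q' = pull beta (pull alpha q').
  by apply/lfunP => u; apply/lfunP => v; rewrite !pullE !comp_lfunE.
by apply: (proj2 hb); apply: (proj2 ha).
Qed.

Lemma induced_by_act alpha (sigma : Defs.pmap V W) f :
  preserves alpha -> induced_by sigma f ->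
  induced_by (cong_act alpha sigma) (fun u => conic_act W0 alpha (f (alpha u))).
Proof.
move=> ha hs P Q; have [a0 _] := ha; rewrite /cong_act; split.
  case E: (proj_map alpha P) => [P1|//] /=.
  case E1: (sigma P1) => [Q1|//] /= /proj_mapP <-.
  move/proj_mapP: E; move/hs: E1 => [u [-> ->]] e.
  exists (alpha^-1%VF u); rewrite lker0_lfunVK // limg_line; split=> //.
  by rewrite -limg_line -e -limg_comp lker0_compVf // lim1g.
case=> u [hP hQ].
(* Both intermediate vectors, [alpha u] and [f (alpha u)], span lines by injectivity, hence give
   points. *)
have d1 : \dim <[alpha u]>%VS == 1%N.
  by rewrite -limg_line -hP limg_dim_eq ?(valP P) // (eqP a0) capv0.
have [P1 hP1] : exists P1 : proj V, val P1 = <[alpha u]>%VS.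
  by exists (Sub <[alpha u]>%VS d1); rewrite SubK.
have -> : proj_map alpha P = Some P1 by apply/proj_mapP; rewrite hP limg_line.
have d : \dim <[f (alpha u)]>%VS == 1%N.
  move: (valP Q); rewrite /= hQ -limg_line limg_dim_eq //.
  by rewrite (eqP (conic_act_inj ha)) capv0.
have [Q1 hQ1] : exists Q1 : proj W, val Q1 = <[f (alpha u)]>%VS.
  by exists (Sub <[f (alpha u)]>%VS d); rewrite SubK.
have e1 : sigma P1 = Some Q1 by apply/hs; exists (alpha u).
rewrite /= e1 /=.
by apply/proj_mapP; rewrite hQ1 limg_line.
Qed.

End CongruenceAction.

Lemma linfun_pullE (K : fieldType) (U W : vectType K) (g : 'Hom(U, W)) (b : bil W) :
  linfun (pull g) b = pull g b.
Proof. exact: lfunE. Qed.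

(** * Reduction of finiteness to a finite list of normal forms *)

Section FiniteFibre.
Variables (K : fieldType) (V : vectType K) (W0 : {vspace bil V}).
Variable G : set 'End(V).
Local Notation W := (subvs_of W0).
Hypothesis G_preserves : forall alpha, G alpha -> preserves W0 alpha.
Hypothesis G_comp : forall alpha beta, G alpha -> G beta -> G (alpha \o beta)%VF.
Hypothesis G_inv : forall alpha, G alpha -> G (alpha^-1)%VF.

(** Both sides have the same lift to vectors, and a lift determines the partial map. *)
Lemma cong_act_comp alpha beta (sigma : Defs.pmap V W) f :
  G alpha -> G beta -> induced_by sigma f ->
  cong_act beta (cong_act alpha sigma) = cong_act (alpha \o beta)%VF sigma.
Proof.
move=> ha hb hs; apply: induced_by_inj.
  exact: induced_by_act (G_preserves hb) (induced_by_act (G_preserves ha) hs).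
have := induced_by_act (G_preserves (G_comp ha hb)) hs.
apply: (eq_induced_by (oner_neq0 K)) => u; rewrite scale1r comp_lfunE.
exact: conic_act_comp (G_preserves ha) (G_preserves hb) _.
Qed.

Lemma cong_actK alpha (sigma : Defs.pmap V W) f :
  G alpha -> induced_by sigma f ->
  cong_act alpha^-1%VF (cong_act alpha sigma) = sigma.
Proof.
move=> ha hs; rewrite (cong_act_comp ha (G_inv ha) hs).
have a0 := proj1 (G_preserves ha).
apply: induced_by_inj (hs).
have := induced_by_act (G_preserves (G_comp ha (G_inv ha))) hs.
apply: (eq_induced_by (oner_neq0 K)) => u; rewrite scale1r lker0_compfV // id_lfunE.
apply: val_inj; rewrite val_conic_act; last first.
  by have := G_preserves (G_comp ha (G_inv ha)); rewrite lker0_compfV.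
by apply/lfunP => v; apply/lfunP => w; rewrite pullE !id_lfunE.
Qed.

Lemma cong_orbit_act alpha (sigma : Defs.pmap V W) f :
  G alpha -> induced_by sigma f ->
  cong_orbit G (cong_act alpha sigma) = cong_orbit G sigma.
Proof.
move=> ha hs; have ga := induced_by_act (G_preserves ha) hs.
apply/seteqP; split=> tau [beta hb <-].
  by rewrite (cong_act_comp ha hb hs); exists (alpha \o beta)%VF => //; apply: G_comp.
exists (alpha^-1 \o beta)%VF; first by apply: G_comp => //; apply: G_inv.
by rewrite -(cong_act_comp (G_inv ha) hb ga) (cong_actK ha hs).
Qed.

Variables (I : finType) (X : I -> W) (xi : I -> dual W).
Hypothesis coordX : forall w, w = \sum_i (xi i w : K) *: X i.

Lemma dual_coord (eta : dual W) : eta = \sum_i (eta (X i) : K) *: xi i.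
Proof.
apply/lfunP => w; rewrite {1}(coordX w) sum_lfunE linear_sum.
by apply: eq_bigr => i _; rewrite linearZ scale_lfunE; apply: mulrC.
Qed.

(** The lift to vectors of the map with transpose [s]: composing it with a functional [eta] gives
    the quadratic form of [s eta]. *)
Definition pullback_fun (s : 'Hom(dual W, bil V)) (u : V) : W :=
  \sum_i (s (xi i) u u : K) *: X i.

Lemma pullback_funE s (eta : dual W) u : eta (pullback_fun s u) = s eta u u.
Proof.
rewrite {2}(dual_coord eta) !linear_sum !sum_lfunE.
by apply: eq_bigr => i _; rewrite !linearZ !scale_lfunE; apply: mulrC.
Qed.

Lemma pullback_lineP s (P : proj V) (Q : proj W) :
  (exists u, val P = <[u]>%VS /\ val Q = <[pullback_fun s u]>%VS) <->
  exists u w, [/\ val P = <[u]>%VS, val Q = <[w]>%VS &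
                  forall eta : dual W, eta w = s eta u u].
Proof.
split=> [[u [hP hQ]]|[u [w [hP hQ e]]]].
  by exists u, (pullback_fun s u); split=> // eta; rewrite pullback_funE.
exists u; split=> //; suff -> : pullback_fun s u = w by [].
by rewrite [RHS]coordX; apply: eq_bigr => i _; rewrite e.
Qed.

Lemma pullback_induced_by sigma s :
  pullback sigma s -> induced_by sigma (pullback_fun s).
Proof.
by case=> _ _ hs P Q; apply: iff_trans (hs P Q) (iff_sym (pullback_lineP s P Q)).
Qed.

Lemma induced_by_pullback sigma s :
  (limg s <= sym2 V)%VS -> no_common_factor s ->
  induced_by sigma (pullback_fun s) -> pullback sigma s.
Proof.
move=> h1 h2 hs.
exact: And3 h1 h2 (fun P Q => iff_trans (hs P Q) (pullback_lineP s P Q)).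
Qed.

(** A common factor is a property of the linear system, not of its parametrization. *)
Lemma no_common_factor_limg (s t : 'Hom(dual W, bil V)) :
  limg s = limg t -> no_common_factor s -> no_common_factor t.
Proof.
move=> e [h1 h2]; split=> [m m0 h|q]; last by rewrite -e; apply: h2.
apply: (h1 m m0) => eta.
have /memv_imgP[eta' _ ->] : s eta \in limg t by rewrite -e memv_img ?memvf.
exact: h.
Qed.

(** Compatibility of [Phi] with the action, in the direction that carries a representative for the
    transformed congruence back to [sigma]. *)
Lemma Phi_act alpha (sigma : Defs.pmap V W) phi s0 :
  G alpha -> pullback sigma s0 -> pullback_iso s0 ->
  Phi (cong_act alpha sigma) phi -> Phi sigma (pull (conic_act W0 alpha) phi).
Proof.
move=> ha ps0 [is0 ls0] [[iphi fphi] [s [ps [is1 ls] sphi]]].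
have pa := G_preserves ha; have [a0 _] := pa; have hb := G_inv ha.
have pb := G_preserves hb.
set g := conic_act W0 alpha; pose h := conic_act W0 (alpha^-1)%VF.
have g0 : lker g == 0%VS by apply: conic_act_inj (G_preserves ha).
have h0 : lker h == 0%VS by apply: conic_act_inj pb.
have hg w : h (g w) = w.
  apply: val_inj; rewrite !val_conic_act //.
  by apply/lfunP => u; apply/lfunP => v; rewrite !pullE !lker0_lfunVK.
have gh w : g (h w) = w.
  by apply: (lker0P h0); rewrite hg.
(* The transpose of [sigma], obtained by letting [alpha^-1] act on the transformed congruence; it
   will be inverse to [pull g phi]. *)
pose t : 'Hom(dual W, bil V) := (linfun (pull (alpha^-1)%VF) \o (s \o tr h))%VF.
have tE eta u v : t eta u v = s (eta \o h)%VF ((alpha^-1)%VF u) ((alpha^-1)%VF v).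
  rewrite /t comp_lfunE comp_lfunE -trE.
  move: (s (tr h eta)) => q.
  by rewrite linfun_pullE pullE.
have tphi w : t (pull g phi w) = val w.
  apply/lfunP => u; apply/lfunP => v; rewrite tE.
  have -> : (pull g phi w \o h)%VF = phi (g w).
    by apply/lfunP => w'; rewrite comp_lfunE pullE gh.
  rewrite sphi; change (vsval (g w)) with (val (g w)).
  by rewrite val_conic_act ?pullE ?lker0_lfunVK.
have t0 : lker t == 0%VS.
  apply/lker0P => eta eta' e.
  have e2 : (eta \o h)%VF = (eta' \o h)%VF.
    apply: (lker0P is1); apply/lfunP => u; apply/lfunP => v.
    move/lfunP: e => /(_ (alpha u)) /lfunP /(_ (alpha v)).
    by rewrite !tE !lker0_lfunK.
  apply/lfunP => w; move/lfunP: e2 => /(_ (g w)).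
  by rewrite comp_lfunE hg comp_lfunE hg.
have lt : limg t = W0.
  apply/vspaceP => q; apply/idP/idP.
    case/memv_imgP => eta _ ->.
    have sW : s (eta \o h)%VF \in W0.
      by have := memv_img s (memvf (eta \o h)%VF); rewrite ls.
    by have := proj2 pb _ sW; rewrite /t comp_lfunE comp_lfunE lfunE trE.
  move=> qW; apply/memv_imgP; exists (pull g phi (vsproj W0 q)); rewrite ?memvf //.
  by rewrite tphi /= vsprojK.
have pgphi0 : lker (pull g phi) == 0%VS.
  apply/lker0P => w w' e; apply: (lker0P g0); apply: (lker0P iphi).
  apply/lfunP => v; move/lfunP: e => /(_ (h v)).
  by rewrite !pullE gh.
split.
  split=> //; apply/eqP; rewrite eqEsubv subvf /=; apply/subvP => eta _.
  apply/memv_imgP.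
  have /memv_imgP[w _ e] : (eta \o h)%VF \in limg phi by rewrite fphi memvf.
  exists (h w); rewrite ?memvf //; apply/lfunP => v.
  by rewrite pullE gh -e comp_lfunE hg.
exists t; split=> //.
have [m0 n0 _] := ps0.
apply: induced_by_pullback.
(* Both [t] and [s0] have image [W0], so symmetry and the absence of common factors pass from [s0]
   to [t]. *)
- by rewrite lt -ls0.
- by apply: no_common_factor_limg n0; rewrite lt.
have hs := pullback_induced_by ps0.
rewrite -(cong_actK ha hs).
have := induced_by_act pb (pullback_induced_by ps).
apply: (eq_induced_by (oner_neq0 K)) => u; rewrite scale1r.
apply: (lker0P g0); rewrite gh.
rewrite [LHS]coordX [RHS]coordX; apply: eq_bigr => i _; congr (_ *: _).
have -> : xi i (g (pullback_fun t u)) = (xi i \o g)%VF (pullback_fun t u).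
  by rewrite comp_lfunE.
rewrite !pullback_funE tE; congr (s _ _ _); apply/lfunP => w.
by rewrite comp_lfunE comp_lfunE gh.
Qed.

(** Every class over [o] is the orbit of the map induced by some [F n], and this orbit depends on
    [n] alone; so there are at most as many classes as normal forms. *)
Lemma finite_fibre (T : eqType) (F : T -> V -> W) (N : seq T) o :
  (forall phi g, o phi -> lker g == 0%VS -> o (pull g phi)) ->
  (forall sigma phi, Cong sigma -> Phi sigma phi -> o phi ->
     exists2 n, n \in N & exists2 alpha, G alpha &
       induced_by (cong_act alpha sigma) (F n)) ->
  finite_set (fibre W0 G o).
Proof.
move=> hpull hN.
pose P n : set (set (Defs.pmap V W)) :=
  [set O | exists2 sigma, induced_by sigma (F n) & O = cong_orbit G sigma].
(* [P n] has at most one element, selected by [xget]; the default [set0] covers the case where no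
   partial map is induced by [F n]. *)
apply: (@sub_finite_set _ _ ((fun n => xget set0 (P n)) @` [set` N])); last first.
  exact: finite_image (finite_seq N).
move=> _ [[sigma hs <-] [sigma' [alpha ha <-] [phi hphi ophi]]].
have [[[s0 ps0 is0] _] _] := hs.
(* [phi] belongs to the transform of [sigma] by [alpha]; it is moved back to [sigma] and stays in
   [o], which is stable under [pull]. *)
have hphi' := Phi_act ha ps0 is0 hphi.
have g0 := conic_act_inj (G_preserves ha).
have [n nN [beta hb hn]] := hN _ _ hs hphi' (hpull _ _ ophi g0).
exists n => //; apply: xget_subset1.
  exists (cong_act beta sigma) => //.
  by rewrite (cong_orbit_act hb (pullback_induced_by ps0)).
by move=> _ _ [t1 h1 ->] [t2 h2 ->]; rewrite (induced_by_inj h1 h2).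
Qed.
End FiniteFibre.

(** * The matrix of a congruence *)

Section CongruenceMatrix.
Variables (K : fieldType) (V : vectType K) (W0 : {vspace bil V}).
Local Notation W := (subvs_of W0).
Variables (n : nat) (X : 'I_n -> W) (xi : 'I_n -> dual W).
Hypothesis coordX : forall w, w = \sum_i (xi i w : K) *: X i.
Hypothesis xiX : forall i j, xi i (X j) = (i == j)%:R.

Definition matrix_map (B : 'M[K]_n) (u : V) : W :=
  \sum_i (\sum_j B i j * vsval (X j) u u : K) *: X i.

Lemma matrix_mapZ k B u : matrix_map (k *: B) u = k *: matrix_map B u.
Proof.
rewrite /matrix_map scaler_sumr; apply: eq_bigr => i _.
rewrite scalerA mulr_sumr; congr (_ *: _); apply: eq_bigr => j _.
by rewrite mxE mulrA.
Qed.

Lemma val_matrix_map B u v w :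
  vsval (matrix_map B u) v w =
  \sum_i \sum_j B i j * vsval (X i) v w * vsval (X j) u u.
Proof.
rewrite /matrix_map linear_sum !sum_lfunE; apply: eq_bigr => i _.
rewrite linearZ !scale_lfunE -[LHS]/(_ * _) mulr_suml.
by apply: eq_bigr => j _; rewrite mulrAC.
Qed.

Lemma bilE (b : bil W) v w :
  b v w = \sum_i \sum_j xi i v * xi j w * b (X i) (X j).
Proof.
rewrite {1}[v]coordX linear_sum sum_lfunE; apply: eq_bigr => i _.
rewrite linearZ scale_lfunE {1}[w]coordX linear_sum scaler_sumr.
by apply: eq_bigr => j _; rewrite linearZ -[LHS]/(_ * (_ * _)) mulrA.
Qed.

(** [B] is the matrix of the transpose, inverse to the matrix [F] of [phi]. A change of basis
    multiplies [det (F^T + t F)] by a constant, so the polynomial [det (B + t B^T)] is, up to a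
    scalar, an invariant of the orbit of [phi0]. *)
Lemma congruence_matrix sigma phi phi0 (g : 'End(W)) :
  Cong sigma -> Phi sigma phi -> phi = pull g phi0 ->
  let F0 : 'M[K]_n := \matrix_(i, j) phi0 (X i) (X j) in
  exists B : 'M[K]_n,
  [/\ induced_by sigma (matrix_map B),
      forall u, \sum_i \sum_j B i j * vsval (X i) u u * vsval (X j) u u = 0,
      B^T != - B,
      B \in unitmx &
      exists k, forall t, \det (B + t *: B^T) = k * \det (F0^T + t *: F0)].
Proof.
move=> [[_ inc] nanti] hphi ephi F0.
have [_ [s [ps [is1 ls] sphi]]] := hphi.
have sW i : s (xi i) \in W0 by have := memv_img s (memvf (xi i)); rewrite ls.
pose B : 'M[K]_n := \matrix_(i, j) xi j (vsproj W0 (s (xi i))).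
have sB i : s (xi i) = \sum_j B i j *: vsval (X j).
  rewrite -{1}(vsprojK (sW i)) {1}[vsproj _ _]coordX linear_sum.
  by apply: eq_bigr => j _; rewrite linearZ mxE.
have sBu i u v : s (xi i) u v = \sum_j B i j * vsval (X j) u v.
  by rewrite sB !sum_lfunE; apply: eq_bigr => j _; rewrite !scale_lfunE.
have hB u : pullback_fun X xi s u = matrix_map B u.
  by apply: eq_bigr => i _; rewrite sBu.
have hs : induced_by sigma (matrix_map B).
  have := pullback_induced_by coordX ps.
  by apply: (eq_induced_by (oner_neq0 K)) => u; rewrite scale1r hB.
pose F : 'M[K]_n := \matrix_(i, j) phi (X i) (X j).
have FB : F *m B = 1%:M.
  apply/matrixP => i k; rewrite !mxE.
  have -> : (i == k)%:R = xi k (vsproj W0 (s (phi (X i)))).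
    by rewrite sphi vsvalK xiX eq_sym.
  rewrite [phi (X i)](dual_coord coordX) !linear_sum; apply: eq_bigr => j _.
  by rewrite !linearZ !mxE.
have [uF uB] := mulmx1_unit FB.
exists B; split=> //.
(* Incidence is given only where the map is defined; where the lift vanishes the identity is
   trivial. *)
- move=> u; have [f0|f0] := eqVneq (matrix_map B u) 0.
    by rewrite -val_matrix_map f0 linear0 !zero_lfunE.
  have u0 : u != 0.
    apply: contra_neq f0 => ->; apply: big1 => i _.
    by rewrite big1 ?scale0r // => j _; rewrite linear0 mulr0.
  have [P hP] : exists P : proj V, val P = <[u]>%VS.
    have d : \dim <[u]>%VS == 1%N by rewrite dim_vline u0.
    by exists (Sub <[u]>%VS d); rewrite SubK.
  have [Q hQ] : exists Q : proj W, val Q = <[matrix_map B u]>%VS.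
    have d : \dim <[matrix_map B u]>%VS == 1%N by rewrite dim_vline f0.
    by exists (Sub <[matrix_map B u]>%VS d); rewrite SubK.
  have /inc : sigma P = Some Q by apply/hs; exists u.
  move=> /(_ u (matrix_map B u)); rewrite hP hQ !memv_line val_matrix_map.
  exact.
(* The inverse of an antisymmetric matrix is antisymmetric, so [phi] would be antisymmetric, against
   the definition of [Cong]. *)
- apply/eqP => BT; apply: (nanti _ hphi).
  have FT : F^T = - F.
    have e : F^T *m B = - 1%:M.
      rewrite -[B]opprK -BT mulmxN; congr (- _).
      by rewrite -trmx_mul -[RHS]trmx1; congr (_^T); apply: mulmx1C.
    by rewrite -[LHS](mulmxK uB) e -[in RHS](mulmxK uB F) FB mulNmx.
  have FTe i j : phi (X j) (X i) = - phi (X i) (X j).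
    by move/matrixP: FT => /(_ i j); rewrite !mxE.
  move=> v w; rewrite !bilE exchange_big -sumrN; apply: eq_bigr => i _.
  rewrite -sumrN; apply: eq_bigr => j _.
  by rewrite FTe mulrN [_ * xi _ _]mulrC.
pose H : 'M[K]_n := \matrix_(i, j) xi j (g (X i)).
have FH : F = H *m F0 *m H^T.
  apply/matrixP => i j; rewrite !mxE ephi pullE bilE exchange_big.
  apply: eq_bigr => l _; rewrite !mxE mulr_suml; apply: eq_bigr => k _.
  by rewrite !mxE mulrAC.
have F0t t : F^T + t *: F = H *m (F0^T + t *: F0) *m H^T.
  rewrite FH !trmx_mul trmxK mulmxA.
  by rewrite mulmxDr mulmxDl -scalemxAr -scalemxAl.
have FBt t : F *m (B + t *: B^T) *m F^T = F^T + t *: F.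
  rewrite mulmxDr FB mulmxDl mul1mx -scalemxAr -scalemxAl; congr (_ + _ *: _).
  by rewrite -mulmxA -trmx_mul FB trmx1 mulmx1.
(* The constant comes from the determinants of the two expressions of [F^T + t F], through [B] and
   through [F0]. *)
exists (\det H ^+ 2 / \det F ^+ 2) => t.
have dF : \det F != 0 by rewrite -unitfE -unitmxE.
have := congr1 determinant (FBt t); rewrite F0t !det_mulmx !det_tr => e.
by apply: (mulfI dF); apply: (mulIf dF); rewrite e; field.
Qed.
End CongruenceMatrix.

(** * The stabilizer of C as a group preserving the space of conics *)

Section Stabilizer.
Variables (K : fieldType) (V : vectType K) (L : {vspace V}) (c : bil (subvs_of L)).

Lemma pull_restrict (alpha : 'End(V)) u v :
  pull (linfun (@vsproj _ _ L) \o (alpha \o linfun (@vsval _ _ L)))%VF c u v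
  = c (vsproj L (alpha (vsval u))) (vsproj L (alpha (vsval v))).
Proof. by rewrite pullE !comp_lfunE !lfunE. Qed.

Lemma stabilizerP (alpha : 'End(V)) :
  stabilizer c alpha <-> [/\ lker alpha == 0%VS, (alpha @: L)%VS = L &
    exists2 a : K, a != 0 & forall u v : subvs_of L,
      c (vsproj L (alpha (vsval u))) (vsproj L (alpha (vsval v))) = a * c u v].
Proof.
split=> -[h1 h2 [a a0 ha]]; split=> //; exists a => //.
  by move=> u v; rewrite -pull_restrict ha !scale_lfunE.
by apply/lfunP => u; apply/lfunP => v; rewrite pull_restrict ha !scale_lfunE.
Qed.

Lemma stabilizer_mem alpha v : stabilizer c alpha -> v \in L -> alpha v \in L.
Proof. by case=> _ h _ vL; rewrite -h memv_img. Qed.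

(** On [L] the form [q] is [k c], and [alpha] scales [c] by [a], so [pull alpha q] restricts to
    [k a c]. *)
Lemma stabilizer_preserves alpha :
  stabilizer c alpha -> preserves (conics_through c) alpha.
Proof.
move=> ha; have /stabilizerP[a0 _ [a _ hc]] := ha; split; first exact: a0.
move=> q /conics_throughP[qs [k hq]]; apply/conics_throughP; split.
  by move=> u v; rewrite !pullE qs.
exists (k * a) => u v; rewrite pullE -mulrA -hc.
rewrite -(vsprojK (stabilizer_mem ha (subvsP u))).
rewrite -(vsprojK (stabilizer_mem ha (subvsP v))).
by rewrite hq !vsprojK ?subvsP // (stabilizer_mem ha (subvsP _)).
Qed.

Lemma stabilizer_comp alpha beta :
  stabilizer c alpha -> stabilizer c beta -> stabilizer c (alpha \o beta)%VF.
Proof.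
move=> ha hb.
have /stabilizerP[a0 a1 [a ka hca]] := ha; have /stabilizerP[b0 b1 [b kb hcb]] := hb.
apply/stabilizerP; split.
- apply/lker0P => u v; rewrite !comp_lfunE => e.
  exact: (lker0P b0) _ _ ((lker0P a0) _ _ e).
- by rewrite limg_comp b1.
exists (a * b); first by rewrite mulf_neq0.
move=> u v; rewrite !comp_lfunE -mulrA -hcb -hca.
by rewrite !vsprojK // (stabilizer_mem hb (subvsP _)).
Qed.

Lemma stabilizer_inv alpha : stabilizer c alpha -> stabilizer c (alpha^-1)%VF.
Proof.
move=> ha; have /stabilizerP[a0 a1 [a ka hca]] := ha.
have b1 : (alpha^-1 @: L)%VS = L.
  by rewrite -{1}a1 -limg_comp lker0_compVf // lim1g.
have mem v : v \in L -> (alpha^-1)%VF v \in L by move=> vL; rewrite -b1 memv_img.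
apply/stabilizerP; split=> //.
  by apply/lker0P => u v /(congr1 alpha); rewrite !lker0_lfunVK.
exists a^-1; first by rewrite invr_eq0.
move=> u v; apply: (mulfI ka); rewrite mulrA mulfV // mul1r -hca.
rewrite !vsprojK ?mem ?subvsP // !lker0_lfunVK //.
by rewrite !vsvalK.
Qed.
End Stabilizer.

(** * Coordinates adapted to the quadric *)

Section Frames.
Variables (K : numClosedFieldType) (V : vectType K).

(** A basis of [V] with its dual basis, chosen so that [z] is an equation of [L]. *)
Record frame (L : {vspace V}) (e0 e1 e2 : V) (x y z : dual V) : Prop := Frame {
  frameE : forall u, u = (x u : K) *: e0 + (y u : K) *: e1 + (z u : K) *: e2;
  frame0 : [/\ x e0 = 1, y e0 = 0 & z e0 = 0];
  frame1 : [/\ x e1 = 0, y e1 = 1 & z e1 = 0];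
  frame2 : [/\ x e2 = 0, y e2 = 0 & z e2 = 1];
  frame_mem : forall u, (u \in L) = (z u == 0) }.

Lemma mem_span2 (p q : V) (s t : K) : s *: p + t *: q \in <<[:: p; q]>>%VS.
Proof. by rewrite rpredD // rpredZ // memv_span // !inE eqxx ?orbT. Qed.

Lemma span2P (p q u : V) : u \in <<[:: p; q]>>%VS ->
  exists s t : K, u = s *: p + t *: q.
Proof.
rewrite span_cons span_seq1 => /memv_addP[_ /vlineP[s ->] [_ /vlineP[t ->] ->]].
by exists s, t.
Qed.

Lemma basis2_change (L : {vspace V}) (a b p q : V) :
  basis_of L [:: a; b] -> p \in L -> q \in L ->
  a \in <<[:: p; q]>>%VS -> b \in <<[:: p; q]>>%VS -> basis_of L [:: p; q].
Proof.
move=> hab pL qL ha hb.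
have d : \dim L = 2 by rewrite (@size_basis _ _ _ _ [tuple a; b] hab).
rewrite basisEdim d leqnn andbT -(span_basis hab); apply/span_subvP => v.
by rewrite !inE => /orP[] /eqP ->.
Qed.

Lemma frame_exists (L : {vspace V}) (p q : V) :
  \dim (fullv : {vspace V}) = 3 -> basis_of L [:: p; q] ->
  exists r x y z, frame L p q r x y z.
Proof.
move=> dV hL.
have dL : \dim L = 2 by rewrite (@size_basis _ _ _ _ [tuple p; q] hL).
have [r rL] : exists r, r \notin L.
  apply: contrapT => /forallNP h; have : (fullv <= L)%VS.
    by apply/subvP => v _; have /negP := h v; rewrite negbK.
  by move/dimvS; rewrite dV dL.
have fX : free [:: r; p; q].
  by rewrite free_cons (span_basis hL) rL (basis_free hL).
pose X := [tuple p; q; r].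
have bX : basis_of fullv X.
  rewrite basisEfree subvf dV andbT.
  by rewrite (perm_free (_ : perm_eq _ [:: r; p; q])) // (perm_catC [:: p; q] [:: r]).
have frX := basis_free bX.
have cX (i j : 'I_3) : coord X j X`_i = (i == j)%:R by apply: coord_free.
pose l (i : 'I_3) : dual V := linfun (coord X i : V -> K^o).
have lE i u : l i u = coord X i u by rewrite lfunE.
exists r, (l 0), (l 1), (l 2%:R).
have fE u : u = (l 0 u : K) *: p + (l 1 u : K) *: q + (l 2%:R u : K) *: r.
  rewrite {1}(coord_basis bX (memvf u)) !big_ord_recl big_ord0 addr0 !lE addrA.
  by congr (coord X _ u *: _ + coord X _ u *: _ + coord X _ u *: _); apply: val_inj.
have e0 := cX 0; have e1 := cX 1; have e2 := cX 2%:R.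
have f0 : [/\ l 0 p = 1, l 1 p = 0 & l 2%:R p = 0] by rewrite !lE; split; rewrite e0.
have f1 : [/\ l 0 q = 0, l 1 q = 1 & l 2%:R q = 0] by rewrite !lE; split; rewrite e1.
have f2 : [/\ l 0 r = 0, l 1 r = 0 & l 2%:R r = 1] by rewrite !lE; split; rewrite e2.
split=> // u; apply/idP/eqP.
  rewrite -(span_basis hL) => /span2P[s [t ->]].
  have [_ _ f02] := f0; have [_ _ f12] := f1.
  rewrite linearD !linearZ /= f02 f12.
  by rewrite !scaler0 addr0.
move=> u2; rewrite (fE u) u2 scale0r addr0 rpredD // rpredZ //.
  by apply: basis_mem hL _; rewrite !inE eqxx.
by apply: basis_mem hL _; rewrite !inE eqxx orbT.
Qed.

Lemma bil_span2 (b : bil V) (p q : V) (s t s' t' : K) :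
  b (s *: p + t *: q) (s' *: p + t' *: q)
  = s * s' * b p p + s * t' * b p q + t * s' * b q p + t * t' * b q q.
Proof.
rewrite !linearD !linearZ /= !add_lfunE !scale_lfunE /=.
rewrite -![_ *: _]/(_ * _); ring.
Qed.

(** Over an algebraically closed field a symmetric form on a plane has an isotropic vector; the rest
    depends on the rank, which is 2 for two points and 1 for a double point. *)
Lemma basis_adapted (L : {vspace V}) (b : bil V) :
  \dim L = 2 -> (forall u v, b u v = b v u) ->
  ~ {in L &, forall u v, b u v = 0} ->
  exists p q, basis_of L [:: p; q] /\
    ([/\ b p p = 0, b q q = 0 & b p q != 0] \/
     [/\ b p p != 0, b q q = 0 & b p q = 0]).
Proof.
move=> dL bs bn.
have [a1 [a2 ha]] : exists a1 a2, basis_of L [:: a1; a2].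
  have sb : size (vbasis L) = 2 by rewrite size_tuple.
  move: (vbasisP L) sb; case: (tval (vbasis L))
    => [|a1 [|a2 [|a3 l]]] // h _.
  by exists a1, a2.
have [p [q [hpq bp]]] : exists p q, basis_of L [:: p; q] /\ b p p = 0.
  have [A0|A0] := eqVneq (b a1 a1) 0; first by exists a1, a2.
  (* Root of the quadratic equation saying that [r *: a1 + a2] is isotropic. *)
  pose r : K := (- b a1 a2 + sqrtC (b a1 a2 ^+ 2 - b a1 a1 * b a2 a2)) / b a1 a1.
  have a1L : a1 \in L by apply: basis_mem ha _; rewrite !inE eqxx.
  have a2L : a2 \in L by apply: basis_mem ha _; rewrite !inE eqxx orbT.
  exists (r *: a1 + a2), a1; split.
    apply: (basis2_change ha) => //; first by rewrite rpredD // rpredZ.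
      by have := mem_span2 (r *: a1 + a2) a1 0 1; rewrite scale0r scale1r add0r.
    have := mem_span2 (r *: a1 + a2) a1 1 (- r).
    by rewrite scale1r scaleNr addrAC subrr add0r.
  rewrite -[a2]scale1r bil_span2 (bs a2 a1).
  have := sqrtCK (b a1 a2 ^+ 2 - b a1 a1 * b a2 a2 : K).
  set w := sqrtC _ in r * => hw.
  have -> : r * r * b a1 a1 + r * 1 * b a1 a2 + 1 * r * b a1 a2 + 1 * 1 * b a2 a2
     = (w ^+ 2 - (b a1 a2 ^+ 2 - b a1 a1 * b a2 a2)) / b a1 a1 by rewrite /r; field.
  by rewrite hw subrr mul0r.
have pL : p \in L by apply: basis_mem hpq _; rewrite !inE eqxx.
have qL : q \in L by apply: basis_mem hpq _; rewrite !inE eqxx orbT.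
have [B0|B0] := eqVneq (b p q) 0.
  have [C0|C0] := eqVneq (b q q) 0.
    case: bn => u v; rewrite -(span_basis hpq) => /span2P[s [t ->]] /span2P[s' [t' ->]].
    by rewrite bil_span2 (bs q p) bp B0 C0 !mulr0 !addr0.
  (* Rank one: [p] spans the kernel, so the two vectors are exchanged. *)
  exists q, p; split; last by right; rewrite (bs q p).
  apply: (basis2_change hpq) => //.
    by have := mem_span2 q p 0 1; rewrite scale0r scale1r add0r.
  by have := mem_span2 q p 1 0; rewrite scale0r scale1r addr0.
(* Makes [q + k *: p] isotropic, while its product with [p] stays [b p q]. *)
pose k : K := - (b q q / (2 * b p q)).
exists p, (q + k *: p); split.
  apply: (basis2_change hpq) => //; first by rewrite rpredD // rpredZ.
    by have := mem_span2 p (q + k *: p) 1 0; rewrite scale0r scale1r addr0.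
  have := mem_span2 p (q + k *: p) (- k) 1.
  by rewrite scale1r scaleNr addrCA addNr addr0.
have e1 : q + k *: p = k *: p + 1 *: q by rewrite scale1r addrC.
rewrite e1; left; split=> //.
  by rewrite bil_span2 (bs q p) bp /k; field.
have := bil_span2 b p q 1 0 k 1; rewrite !scale0r !scale1r !addr0 => ->.
by rewrite bp !mulr0 !mul0r add0r !addr0 !mul1r.
Qed.
End Frames.

(** * A basis of the conics through C *)

Section ConicBasis.
Variables (K : numClosedFieldType) (V : vectType K).

Definition rank1_fun (E : vectType K) (l : dual V) (w : E) (u : V) : E :=
  (l u : K) *: w.

Lemma rank1_fun_is_linear (E : vectType K) l (w : E) : linear (rank1_fun l w).
Proof. by move=> a u v; rewrite /rank1_fun linearD linearZ scalerDl scalerA. Qed.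
HB.instance Definition _ (E : vectType K) l (w : E) :=
  GRing.isLinear.Build K V E _ (rank1_fun l w) (rank1_fun_is_linear l w).

(* Polar form of 2 m n. *)
Definition sprod (m n : dual V) : bil V :=
  linfun (rank1_fun m n) + linfun (rank1_fun n m).

Lemma sprodE m n u v : sprod m n u v = (m u : K) * n v + (n u : K) * m v.
Proof.
have e m' n' : (linfun (rank1_fun m' n') : bil V) u v = (m' u : K) * n' v.
  by rewrite lfunE /= /rank1_fun scale_lfunE.
by rewrite /sprod !add_lfunE !e.
Qed.

Lemma sprodC m n u v : sprod m n u v = sprod m n v u.
Proof.
rewrite !sprodE; apply: etrans (addrC _ _) _.
by congr (_ + _); apply: mulrC.
Qed.

Definition entry (W0 : {vspace bil V}) (k : K) (p q : V) (w : subvs_of W0) : K^o :=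
  k * vsval w p q.

Lemma entry_is_linear W0 k p q : linear (@entry W0 k p q).
Proof.
move=> a w w'; rewrite /entry linearD linearZ !add_lfunE !scale_lfunE.
rewrite -![_ *: _]/(_ * _) mulrDr; congr (_ + _); apply: mulrCA.
Qed.
HB.instance Definition _ W0 k p q :=
  GRing.isLinear.Build K (subvs_of W0) K^o _ (@entry W0 k p q)
    (@entry_is_linear W0 k p q).

Lemma vsval_lincomb (W0 : {vspace bil V}) n (a : 'I_n -> K)
    (X : 'I_n -> subvs_of W0) u v :
  vsval (\sum_i a i *: X i) u v = \sum_i a i * vsval (X i) u v.
Proof.
rewrite linear_sum !sum_lfunE; apply: eq_bigr => i _.
by rewrite linearZ !scale_lfunE.
Qed.

Variables (L : {vspace V}) (e0 e1 e2 : V) (x y z : dual V).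
Hypothesis fr : frame L e0 e1 e2 x y z.

Lemma frame_ext (u v : V) : x u = x v -> y u = y v -> z u = z v -> u = v.
Proof. by move=> hx hy hz; rewrite (frameE fr u) (frameE fr v) hx hy hz. Qed.

Lemma frame_bilE (w : bil V) (u v : V) :
  w u v = (x u : K) * x v * w e0 e0 + (x u : K) * y v * w e0 e1
    + (x u : K) * z v * w e0 e2 + (y u : K) * x v * w e1 e0
    + (y u : K) * y v * w e1 e1 + (y u : K) * z v * w e1 e2
    + (z u : K) * x v * w e2 e0 + (z u : K) * y v * w e2 e1
    + (z u : K) * z v * w e2 e2.
Proof.
have D (p : V) : w p v = (x v : K) * w p e0 + (y v : K) * w p e1 + (z v : K) * w p e2.
  by rewrite {1}(frameE fr v) !linearD !linearZ.
have D' (p : V) : w u p = (x u : K) * w e0 p + (y u : K) * w e1 p + (z u : K) * w e2 p.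
  by rewrite {1}(frameE fr u) !linearD !linearZ /= !add_lfunE !scale_lfunE.
rewrite D' !D; ring.
Qed.

Variables (c : bil (subvs_of L)) (k : K) (dbl : bool).
Hypothesis k0 : k != 0.
Hypothesis cE : forall u v : subvs_of L,
  c u v = k * sprod x (if dbl then x else y) (vsval u) (vsval v).

Local Notation W := (subvs_of (conics_through c)).

Lemma sprod_z_mem (m : dual V) : sprod m z \in conics_through c.
Proof.
apply/conics_throughP; split; first exact: sprodC.
exists 0 => u v; rewrite mul0r sprodE.
have zL (w : subvs_of L) : z (vsval w) = 0.
  by apply/eqP; rewrite -(frame_mem fr) subvsP.
by rewrite !zL mulr0 mul0r addr0.
Qed.

Lemma sprod_x_mem : sprod x (if dbl then x else y) \in conics_through c.
Proof.
apply/conics_throughP; split; first exact: sprodC.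
by exists k^-1 => u v; rewrite cE mulKf.
Qed.

(** Of the six entries of a symmetric form, the condition on [L] kills two; the other four are the
    coordinates. *)
Lemma conics_basis : exists (X : 'I_4 -> W) (xi : 'I_4 -> dual W),
  [/\ forall w, w = \sum_i (xi i w : K) *: X i,
      forall i j, xi i (X j) = (i == j)%:R &
      forall i, vsval (X i) = nth 0 [:: sprod z z; sprod x z; sprod y z;
                     sprod x (if dbl then x else y)] i].
Proof.
pose s := [:: sprod z z; sprod x z; sprod y z; sprod x (if dbl then x else y)].
pose X (i : 'I_4) : W := vsproj _ (nth 0 s i).
have XE i : vsval (X i) = nth 0 s i.
  apply: vsprojK; case: i => -[|[|[|[|i]]]] //= _; rewrite ?sprod_z_mem //.
  exact: sprod_x_mem.
(* The factor [2^-1] compensates [sprod z z e2 e2 = 2], and likewise for [sprod x x]. *)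
pose xi (i : 'I_4) : dual W := nth 0 [:: linfun (@entry _ 2^-1 e2 e2);
  linfun (@entry _ 1 e0 e2); linfun (@entry _ 1 e1 e2);
  if dbl then linfun (@entry _ 2^-1 e0 e0) else linfun (@entry _ 1 e0 e1)] i.
have [x0 y0 z0] := frame0 fr; have [x1 y1 z1] := frame1 fr.
have [x2 y2 z2] := frame2 fr.
have h2 : (2 : K) != 0 by rewrite pnatr_eq0.
have xiE i (w : W) : xi i w = nth 0 [:: 2^-1 * vsval w e2 e2; vsval w e0 e2;
    vsval w e1 e2; if dbl then 2^-1 * vsval w e0 e0 else vsval w e0 e1] i.
  rewrite /xi; case: i => -[|[|[|[|i]]]] //= _; last case: dbl;
    by rewrite lfunE /= /entry ?mul1r.
exists X, xi; split; [move=> w | move=> i j | exact: XE]; last first.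
  rewrite xiE XE /s.
  case: i => -[|[|[|[|i]]]] //= hi; case: j => -[|[|[|[|j]]]] //= hj;
    case: dbl; rewrite sprodE ?x0 ?y0 ?z0 ?x1 ?y1 ?z1 ?x2 ?y2 ?z2;
    rewrite ?mulr0 ?mul0r ?addr0 ?mulr1 ?add0r ?mulr0 //.
  all: rewrite -?mulr2n ?mulVf //.
have /conics_throughP[ws [a wa]] := subvsP w.
have wL p q : p \in L -> q \in L ->
    vsval w p q = a * (k * sprod x (if dbl then x else y) p q).
  by move=> pL qL; have := wa (vsproj L p) (vsproj L q); rewrite cE !vsprojK.
have e0L : e0 \in L by rewrite (frame_mem fr) z0.
have e1L : e1 \in L by rewrite (frame_mem fr) z1.
apply: val_inj; apply/lfunP => u; apply/lfunP => v.
rewrite [LHS]frame_bilE vsval_lincomb.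
under eq_bigr do rewrite xiE XE.
rewrite !big_ord_recl big_ord0 /= !sprodE.
rewrite (ws e2 e0) (ws e2 e1) (ws e1 e0).
(* On [L] the form is a multiple of [c], which has no [y^2] term in either case. *)
have -> : vsval w e1 e1 = 0.
  by rewrite wL // sprodE; case: dbl; rewrite ?x1 ?y1 ?(mulr0, mul0r, addr0).
case: (dbl) wL => wL.
  have -> : vsval w e0 e1 = 0 by rewrite wL // sprodE x1 ?(mulr0, mul0r, addr0).
  by rewrite -[(0 + 0)%N]/0%N /=; field.
have -> : vsval w e0 e0 = 0 by rewrite wL // sprodE y0 ?(mulr0, mul0r, addr0).
by rewrite -[(0 + 0)%N]/0%N /=; field.
Qed.

End ConicBasis.

(** * Frames adapted to C and triangular elements of the stabilizer *)

Section AdaptedFrames.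
Variables (K : numClosedFieldType) (V : vectType K).

Definition adapted_frame (L : {vspace V}) (c : bil (subvs_of L)) (dbl : bool)
    (e0 e1 e2 : V) (x y z : dual V) : Prop :=
  frame L e0 e1 e2 x y z /\ exists2 k : K, k != 0 & forall u v : subvs_of L,
    c u v = k * sprod x (if dbl then x else y) (vsval u) (vsval v).

Lemma adapted_frame_exists (L : {vspace V}) (c : bil (subvs_of L)) :
  \dim (fullv : {vspace V}) = 3 -> \dim L = 2 -> c \in sym2 (subvs_of L) -> c != 0 ->
  exists dbl e0 e1 e2 x y z, @adapted_frame L c dbl e0 e1 e2 x y z.
Proof.
move=> dV dL /sym2P cs c0.
(* [c] is extended to [V] through a projection onto [L], so that the results on forms of [V]
   apply. *)
pose b := pull (linfun (@vsproj _ _ L)) c.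
have bE (u v : subvs_of L) : b (vsval u) (vsval v) = c u v.
  by rewrite pullE !lfunE /= !vsvalK.
have bs u v : b u v = b v u by rewrite !pullE cs.
have bn : ~ {in L &, forall u v, b u v = 0}.
  move=> h; move/eqP: c0; apply; apply/lfunP => u; apply/lfunP => v.
  by rewrite -bE h ?subvsP // !zero_lfunE.
have [p [q [hpq hb]]] := basis_adapted dL bs bn.
have [r [x [y [z fr]]]] := frame_exists dV hpq.
have cE (u v : subvs_of L) : c u v =
    b ((x (vsval u) : K) *: p + (y (vsval u) : K) *: q)
      ((x (vsval v) : K) *: p + (y (vsval v) : K) *: q).
  have vE (w : subvs_of L) : vsval w = (x (vsval w) : K) *: p + (y (vsval w) : K) *: q.
    have /eqP zw : z (vsval w) == 0 by rewrite -(frame_mem fr) subvsP.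
    by rewrite {1}(frameE fr (vsval w)) zw scale0r addr0.
  by rewrite -!vE bE.
case: hb => [[bp bq bpq]|[bp bq bpq]].
  exists false, p, q, r, x, y, z; split=> //; exists (b p q) => // u v.
  rewrite cE bil_span2 (bs q p) bp bq /= sprodE; ring.
exists true, p, q, r, x, y, z; split=> //; exists (b p p / 2).
  by rewrite mulf_neq0 ?invr_eq0 ?pnatr_eq0.
by move=> u v; rewrite cE bil_span2 (bs q p) bpq bq /= sprodE; field.
Qed.

Variables (L : {vspace V}) (c : bil (subvs_of L)) (dbl : bool).
Variables (e0 e1 e2 : V) (x y z : dual V).
Hypothesis ad : adapted_frame c dbl e0 e1 e2 x y z.

Let fr : frame L e0 e1 e2 x y z := proj1 ad.

Lemma endo_coord (l0 l1 l2 : dual V) : exists alpha : 'End(V),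
  forall u, [/\ x (alpha u) = l0 u, y (alpha u) = l1 u & z (alpha u) = l2 u].
Proof.
exists (linfun (rank1_fun l0 e0) + linfun (rank1_fun l1 e1) + linfun (rank1_fun l2 e2)).
move=> u; rewrite !add_lfunE !lfunE /= /rank1_fun !linearD !linearZ /=.
have [x0 y0 z0] := frame0 fr; have [x1 y1 z1] := frame1 fr.
have [x2 y2 z2] := frame2 fr.
rewrite x0 x1 x2 y0 y1 y2 z0 z1 z2 -![_ *: _]/(_ * _).
by rewrite !mulr0 !mulr1 !addr0 !add0r.
Qed.

(** On [L] these maps send [x] to [b x] and [y] to [d y + f x]: they scale [x^2] by [b^2], and [xy]
    by [b d] when [f = 0]. *)
Lemma triangular_stabilizer (b e d f g : K) :
  b != 0 -> d != 0 -> (~~ dbl -> f = 0) ->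
  exists2 alpha, stabilizer c alpha &
  forall u, [/\ x (alpha u) = b * x u + e * z u,
    y (alpha u) = d * y u + f * x u + g * z u & z (alpha u) = z u].
Proof.
move=> b0 d0 f0.
have [alpha ha] := endo_coord (b *: x + e *: z) (d *: y + f *: x + g *: z) z.
have aE u : [/\ x (alpha u) = b * x u + e * z u,
    y (alpha u) = d * y u + f * x u + g * z u & z (alpha u) = z u].
  by have [-> -> ->] := ha u; rewrite !add_lfunE !scale_lfunE.
have a0 : lker alpha == 0%VS.
  apply/lker0P => u v e'.
  have [xu yu zu] := aE u; have [xv yv zv] := aE v.
  move: xu yu zu; rewrite e' xv yv zv => ex ey ez.
  have ex' : x u = x v by move: ex; rewrite ez => /addIr /(mulfI b0).
  by apply: (frame_ext fr) => //; move: ey; rewrite ez ex' => /addIr /addIr /(mulfI d0).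
have aL v : v \in L -> alpha v \in L.
  by rewrite !(frame_mem fr); have [_ _ ->] := aE v.
exists alpha => //; apply/stabilizerP; split=> //.
  apply/eqP; rewrite eqEdim limg_dim_eq ?(eqP a0) ?capv0 // leqnn andbT.
  by apply/subvP => _ /memv_imgP[v vL ->]; apply: aL.
have [_ [k k0 cE]] := ad.
have zL (w : subvs_of L) : z (vsval w) = 0.
  by apply/eqP; rewrite -(frame_mem fr) subvsP.
exists (b * if dbl then b else d).
  by rewrite mulf_neq0 //; case: (dbl).
move=> u v; rewrite !cE !vsprojK ?aL ?subvsP // !sprodE.
have [xu yu _] := aE (vsval u); have [xv yv _] := aE (vsval v).
case: (dbl) f0 => f0; rewrite ?xu ?yu ?xv ?yv !zL; first by ring.
by rewrite f0 //; ring.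
Qed.
End AdaptedFrames.

(** * Matrices of congruences and their normal forms *)

Section StandardMatrices.
Variable K : numClosedFieldType.

(* Q + A, where A has entries a_ij above the diagonal and dbl says that C is a
   double point. *)
Definition std_entry (dbl : bool) (a01 a02 a03 a12 a13 a23 : K) (i j : nat) : K :=
  nth 0 (nth [::]
    [:: [:: 0; a01; a02; a03 - 1];
        [:: - a01; 2 * dbl%:R; a12 + (1 - dbl%:R); a13];
        [:: - a02; - a12 + (1 - dbl%:R); 0; a23];
        [:: - a03 - 1; - a13; - a23; 0]] i) j.

Definition std_mx dbl a01 a02 a03 a12 a13 a23 : 'M[K]_4 :=
  \matrix_(i < 4, j < 4) std_entry dbl a01 a02 a03 a12 a13 a23 i j.

(** Laplace expansion along the first two rows. Entries are indexed by [nat] so that explicit tables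
    compute. *)
Lemma det_mx44 (M : 'M[K]_4) (m : nat -> nat -> K) :
  (forall i j : 'I_4, M i j = m i j) ->
  \det M =
    (m 0 0 * m 1 1 - m 0 1 * m 1 0) * (m 2 2 * m 3 3 - m 2 3 * m 3 2)
  - (m 0 0 * m 1 2 - m 0 2 * m 1 0) * (m 2 1 * m 3 3 - m 2 3 * m 3 1)
  + (m 0 0 * m 1 3 - m 0 3 * m 1 0) * (m 2 1 * m 3 2 - m 2 2 * m 3 1)
  + (m 0 1 * m 1 2 - m 0 2 * m 1 1) * (m 2 0 * m 3 3 - m 2 3 * m 3 0)
  - (m 0 1 * m 1 3 - m 0 3 * m 1 1) * (m 2 0 * m 3 2 - m 2 2 * m 3 0)
  + (m 0 2 * m 1 3 - m 0 3 * m 1 2) * (m 2 0 * m 3 1 - m 2 1 * m 3 0).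
Proof.
move=> E.
rewrite (expand_det_row _ ord0) !big_ord_recl big_ord0 /cofactor.
rewrite !(expand_det_row _ ord0) !big_ord_recl !big_ord0 /cofactor.
rewrite !(expand_det_row _ ord0) !big_ord_recl !big_ord0 /cofactor.
rewrite !det_mx11 !mxE !E /= /bump /=; ring.
Qed.

(** The part of [det (Q + A)] that is quadratic in the entries of [A]. *)
Definition std_det (dbl : bool) (a01 a02 a03 a12 a13 a23 : K) : K :=
  if dbl then - (a12 ^+ 2 + 4 * a02 * a23)
  else 2 * (a02 * a13 + a01 * a23) - a03 ^+ 2 - a12 ^+ 2.

Definition pfaffian (a01 a02 a03 a12 a13 a23 : K) : K :=
  a01 * a23 - a02 * a13 + a03 * a12.

(** As [M + t M^T = (1 + t) Q + (1 - t) A] and transposition changes the sign of [A], only even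
    powers of [1 - t] occur; [1 - dbl] is [det Q], and [det A] is the square of the Pfaffian. *)
Lemma det_std_mx dbl a01 a02 a03 a12 a13 a23 t :
  let M := std_mx dbl a01 a02 a03 a12 a13 a23 in
  \det (M + t *: M^T) = (1 - dbl%:R) * (1 + t) ^+ 4
    + std_det dbl a01 a02 a03 a12 a13 a23 * ((1 + t) ^+ 2 * (1 - t) ^+ 2)
    + pfaffian a01 a02 a03 a12 a13 a23 ^+ 2 * (1 - t) ^+ 4.
Proof.
move=> M.
rewrite (@det_mx44 _ (fun i j => std_entry dbl a01 a02 a03 a12 a13 a23 i j
   + t * std_entry dbl a01 a02 a03 a12 a13 a23 j i)); last first.
  by move=> i j; rewrite /M !mxE.
by rewrite /std_entry /std_det /pfaffian /=; case: (dbl) => /=; ring.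
Qed.

Lemma quartic_eq0 (a b c d e : K) :
  (forall x, a + b * x + c * x ^+ 2 + d * x ^+ 3 + e * x ^+ 4 = 0) ->
  [/\ a = 0, b = 0, c = 0, d = 0 & e = 0].
Proof.
move=> h; have n0 k : (k.+1%:R : K) != 0 by rewrite pnatr_eq0.
have h0 := h 0; have h1 := h 1; have h2 := h (-1); have h3 := h 2; have h4 := h (-2).
have a0 : a = 0 by rewrite -h0; ring.
have e0 : e = 0.
  apply: (mulfI (n0 23)); rewrite mulr0.
  (* The fourth difference of the values at [2], [1], [0], [-1], [-2] is [24 e]; each zero is then
     replaced by a value of the quartic. The other coefficients are isolated by similar
     combinations. *)
  transitivity (0 + 0 - 4 * 0 - 4 * 0 + 6 * 0 : K).
    by rewrite -{1}h3 -{1}h4 -{1}h1 -{1}h2 -{1}h0; ring.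
  by ring.
have c0 : c = 0.
  apply: (mulfI (n0 1)); rewrite mulr0; transitivity (0 + 0 - 2 * 0 - 2 * e : K).
    by rewrite -{1}h1 -{1}h2 -{1}h0; ring.
  by rewrite e0; ring.
have d0 : d = 0.
  apply: (mulfI (n0 11)); rewrite mulr0; transitivity (0 - 0 - 2 * 0 + 2 * 0 : K).
    by rewrite -{1}h3 -{1}h4 -{1}h1 -{1}h2; ring.
  by ring.
split=> //.
by rewrite -h1 a0 c0 d0 e0; ring.
Qed.

Lemma quadratic_eq0 (a b c : K) :
  (forall x, a + b * x + c * x ^+ 2 = 0) -> [/\ a = 0, b = 0 & c = 0].
Proof.
move=> h; have [|-> -> -> _ _] // := @quartic_eq0 a b c 0 0.
by move=> x; rewrite -[RHS](h x); ring.
Qed.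

(** Comparing coefficients in [x], [y], [z] leaves only multiples of the relation [Q] for the
    symmetric part of [B]; the multiple is nonzero because [B] is not antisymmetric. *)
Lemma incident_std_mx dbl (B : 'M[K]_4) :
  (forall x y z : K,
     let X i := nth 0 [:: z * z + z * z; x * z + z * x; y * z + z * y;
       x * (if dbl then x else y) + (if dbl then x else y) * x] i in
     \sum_i \sum_j B i j * X i * X j = 0) ->
  B^T != - B ->
  exists lambda a01 a02 a03 a12 a13 a23, lambda != 0 /\
    B = lambda *: std_mx dbl a01 a02 a03 a12 a13 a23.
Proof.
move=> h Bn; pose m (i j : nat) : K := B (inord i) (inord j).
have E (i j : 'I_4) : B i j = m i j by rewrite /m !inord_val.
have n2 : (2 : K) != 0 by rewrite pnatr_eq0.
have n4 : (4 : K) != 0 by rewrite pnatr_eq0.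
(* For [z = 1], the coefficients of [1], [y] and [y^2] in the identity, divided by 4. *)
pose c0 x := if dbl then m 0 0 + (m 0 1 + m 1 0) * x + (m 1 1 + m 0 3 + m 3 0) * x ^+ 2
   + (m 1 3 + m 3 1) * x ^+ 3 + m 3 3 * x ^+ 4
  else m 0 0 + (m 0 1 + m 1 0) * x + m 1 1 * x ^+ 2 + 0 * x ^+ 3 + 0 * x ^+ 4.
pose c1 x := if dbl then (m 0 2 + m 2 0) + (m 1 2 + m 2 1) * x + (m 2 3 + m 3 2) * x ^+ 2
  else (m 0 2 + m 2 0) + (m 1 2 + m 2 1 + m 0 3 + m 3 0) * x + (m 1 3 + m 3 1) * x ^+ 2.
pose c2 x := if dbl then m 2 2 + 0 * x + 0 * x ^+ 2
  else m 2 2 + (m 2 3 + m 3 2) * x + m 3 3 * x ^+ 2.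
have hc x : [/\ c0 x = 0, c1 x = 0 & c2 x = 0].
  apply: quadratic_eq0 => y; apply: (mulfI n4); rewrite mulr0 -[RHS](h x y 1).
  rewrite /= !big_ord_recl !big_ord0 !E /= /bump /= /c0 /c1 /c2.
  by case: (dbl); ring.
have H0 x : c0 x = 0 by case: (hc x).
have H1 x : c1 x = 0 by case: (hc x).
have H2 x : c2 x = 0 by case: (hc x).
(* The entry of [Q] at (1,1) is 2 for a double point; for two points its entries at (1,2) and (2,1)
   are 1. *)
pose lambda := if dbl then m 1 1 / 2 else (m 1 2 + m 2 1) / 2.
have std : [/\ [/\ m 0 0 = 0, m 2 2 = 0 & m 3 3 = 0],
   [/\ m 1 0 = - m 0 1, m 2 0 = - m 0 2, m 3 1 = - m 1 3 & m 3 2 = - m 2 3],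
   m 1 1 = 2 * dbl%:R * lambda,
   m 2 1 = 2 * (1 - dbl%:R) * lambda - m 1 2 &
   m 3 0 = - m 0 3 - 2 * lambda].
  have A (u v : K) : u + v = 0 -> v = - u.
    by move=> e; apply/eqP; rewrite -addr_eq0 addrC e.
  rewrite /lambda; move: H0 H1 H2; rewrite /c0 /c1 /c2; case: (dbl).
    move=> /quartic_eq0[-> /A-> /A h30 /A-> ->] /quadratic_eq0[/A-> /A-> /A->].
    move=> /quadratic_eq0[-> _ _]; split=> //=; rewrite ?h30; by field.
  move=> /quartic_eq0[-> /A-> -> _ _] /quadratic_eq0[/A-> /A h30 /A->].
  move=> /quadratic_eq0[-> /A-> ->]; split=> //=; rewrite ?h30; by field.
case: std => [[m00 m22 m33] [m10 m20 m31 m32] m11 m21 m30].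
have l0 : lambda != 0.
  apply/eqP => l0; move/eqP: Bn; apply; apply/matrixP => i j; rewrite !mxE !E.
  rewrite l0 !mulr0 ?sub0r ?subr0 in m11 m21 m30.
  case: i => -[|[|[|[|i]]]] //= _; case: j => -[|[|[|[|j]]]] //= _;
    by rewrite ?m00 ?m22 ?m33 ?m10 ?m20 ?m31 ?m32 ?m11 ?m21 ?m30 ?opprK ?oppr0.
(* The shifts by [1] and [1 - dbl] subtract the entries of [Q] from those of [B / lambda]. *)
exists lambda, (m 0 1 / lambda), (m 0 2 / lambda), (m 0 3 / lambda + 1),
  (m 1 2 / lambda - (1 - dbl%:R)), (m 1 3 / lambda), (m 2 3 / lambda); split=> //.
apply/matrixP => i j; rewrite !mxE !E /std_entry.
case: i => -[|[|[|[|i]]]] //= _; case: j => -[|[|[|[|j]]]] //= _;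
  rewrite ?m00 ?m22 ?m33 ?m10 ?m20 ?m31 ?m32 ?m11 ?m21 ?m30;
  by field.
Qed.

End StandardMatrices.

(** * Normal forms of the antisymmetric part *)

Section NormalForms.
Variable K : numClosedFieldType.

Definition params : Type := (K * K * K * K * K * K)%type.

(* The entries a_ij after the substitution x -> b x + e z, y -> d y + f x + g z,
   z -> z, divided by the factor b d (b^2 if dbl) by which it scales Q. *)
Definition std_act (dbl : bool) (b e d f g : K) (a : params) : params :=
  let: (a01, a02, a03, a12, a13, a23) := a in
  if dbl then
    ((b * a01 + f * a02 + 2 * b * e * a03 + (e * f - b * g) * a12 + b * e ^+ 2 * a13
        + (2 * b * e * g - e ^+ 2 * f) * a23) / b ^+ 2,
     d * (a02 + e * a12 - e ^+ 2 * a23) / b ^+ 2,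
     a03 + e * a13 + g * a23,
     d * (a12 - 2 * e * a23) / b,
     b * a13 + f * a23,
     d * a23)
  else
    ((a01 + g * (a03 - a12) + g ^+ 2 * a23) / d,
     (a02 + e * (a03 + a12) + e ^+ 2 * a13) / b,
     a03 + e * a13 + g * a23,
     a12 + e * a13 - g * a23,
     b * a13,
     d * a23).

Definition mx_of_params dbl (a : params) : 'M[K]_4 :=
  let: (a01, a02, a03, a12, a13, a23) := a in std_mx dbl a01 a02 a03 a12 a13 a23.

(** A triple [(p, q, r)] is the binary form with outer coefficients [q], [r] and half middle
    coefficient [p]; the last one occurs for [D = 0]. *)
Definition binary_forms (D : K) : seq (K * K * K) :=
  [:: (0, - D, 1); (sqrtC D, 0, 0); (- sqrtC D, 0, 0); (0, 1, 0)].

Lemma sqrtC_cases (D w : K) : w ^+ 2 = D -> w = sqrtC D \/ w = - sqrtC D.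
Proof.
by move=> h; have /eqP := sqrtCK D; rewrite -h eqf_sqr => /orP[]/eqP->;
  [left|right]; rewrite ?opprK.
Qed.

(* The a_ij split into two binary quadratic forms, on which the substitutions of x
   and of y act separately; the discriminant D is invariant. *)
Lemma binary_formP (p q r D : K) : p ^+ 2 - q * r = D ->
  exists b e, b != 0 /\
    (p + e * r, (q + 2 * e * p + e ^+ 2 * r) / b, b * r) \in binary_forms D.
Proof.
move=> h; rewrite /binary_forms; have [r0|r0] := eqVneq r 0; last first.
  (* A shift removes the middle coefficient, then [r] is scaled to 1. *)
  exists r^-1, (- p / r); rewrite invr_eq0; split=> //.
  rewrite inE (_ : (_, _, _) = (0, - D, 1)) ?eqxx //.
  by rewrite -h; congr (_, _, _); field.
rewrite r0 in h *; rewrite mulr0 subr0 in h; have [p0|p0] := eqVneq p 0.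
  have D0 : D = 0 by rewrite -h p0 expr0n.
  have [q0|q0] := eqVneq q 0.
    (* The zero form is listed as [(sqrtC D, 0, 0)] with [D = 0]. *)
    exists 1, 0; split; first exact: oner_neq0.
    by rewrite D0 p0 q0 sqrtC0 !(mulr0, mul0r, addr0) !inE eqxx orbT.
  exists q, 0; split=> //.
  by rewrite p0 !(mulr0, mul0r, addr0, expr0n) divff // !inE eqxx !orbT.
exists 1, (- q / (2 * p)); split; first exact: oner_neq0.
rewrite [X in X \in _](_ : _ = (p, 0, 0)); last first.
  by congr (_, _, _); field.
by case: (sqrtC_cases h) => ->; rewrite !inE eqxx ?orbT.
Qed.

Lemma params_ext (x1 x2 x3 x4 x5 x6 y1 y2 y3 y4 y5 y6 : K) :
  x1 = y1 -> x2 = y2 -> x3 = y3 -> x4 = y4 -> x5 = y5 -> x6 = y6 ->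
  (x1, x2, x3, x4, x5, x6) = (y1, y2, y3, y4, y5, y6).
Proof. by move=> -> -> -> -> -> ->. Qed.

(** The forms [((a03 + a12) / 2, a02, a13)] and [((a03 - a12) / 2, a01, a23)] are moved by [(b, e)]
    and by [(d, g)] separately. This is the splitting of [so(4)] into two copies of [sl(2)]. *)
Lemma normal_forms_split (D D' : K) : exists N : seq params,
  forall a01 a02 a03 a12 a13 a23,
    ((a03 + a12) / 2) ^+ 2 - a02 * a13 = D ->
    ((a03 - a12) / 2) ^+ 2 - a01 * a23 = D' ->
  exists b e d g, [/\ b != 0, d != 0 &
    std_act false b e d 0 g (a01, a02, a03, a12, a13, a23) \in N].
Proof.
pose join (s t : K * K * K) : params :=
  let: (p, q, r) := s in let: (p', q', r') := t in (q', q, p + p', p - p', r, r').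
exists [seq join s t | s <- binary_forms D, t <- binary_forms D'].
move=> a01 a02 a03 a12 a13 a23 /binary_formP[b [e [b0 h]]] /binary_formP[d [g [d0 h']]].
exists b, e, d, g; split=> //.
rewrite (_ : std_act _ _ _ _ _ _ _ = join
  ((a03 + a12) / 2 + e * a13,
   (a02 + 2 * e * ((a03 + a12) / 2) + e ^+ 2 * a13) / b, b * a13)
  ((a03 - a12) / 2 + g * a23,
   (a01 + 2 * g * ((a03 - a12) / 2) + g ^+ 2 * a23) / d, d * a23)).
  exact: (allpairs_f join h h').
by apply: params_ext; field.
Qed.

(** The scalar [k] is unknown, so only the ratio of [P^2] to [S] is given. The cases follow the
    vanishing of [a23], then of [a12]; substitutions kill most entries, and the ratio determines the
    square of a surviving one. *)
Lemma normal_forms_double (p0 p2 : K) : exists N : seq params,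
  forall a01 a02 a03 a12 a13 a23 k,
    let S := std_det true a01 a02 a03 a12 a13 a23 in
    let P := pfaffian a01 a02 a03 a12 a13 a23 in
    S + P ^+ 2 != 0 -> S + P ^+ 2 = k * p0 -> 16 * P ^+ 2 = k * p2 ->
  exists b e d f g, [/\ b != 0, d != 0 &
    std_act true b e d f g (a01, a02, a03, a12, a13, a23) \in N].
Proof.
(* When [S] is nonzero, [r1^2 = - 4 P^2 / S] and [r2^2 = - P^2 / S]. *)
pose r1 : K := sqrtC (- (4 * p2) / (16 * p0 - p2)).
pose r2 : K := sqrtC (- p2 / (16 * p0 - p2)).
exists [:: (1, 0, 0, 0, 0, 1); (r1, 1, 0, 0, 0, 1); (- r1, 1, 0, 0, 0, 1);
  (0, 0, r2, 1, 1, 0); (0, 0, - r2, 1, 1, 0); (0, 0, r2, 1, 0, 0); (0, 0, - r2, 1, 0, 0);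
  (0, 1, 0, 0, 1, 0)].
move=> a01 a02 a03 a12 a13 a23 k S P nz hS hP.
have k0 : k != 0 by apply: contraNneq nz => k0; rewrite hS k0 mul0r.
(* Elimination of [k] between the two equations. *)
have ratio : P ^+ 2 * (16 * p0 - p2) = S * p2.
  apply: (mulfI k0); transitivity (P ^+ 2 * (16 * (k * p0) - k * p2)); first by ring.
  by rewrite -hS -hP; transitivity (S * (16 * P ^+ 2)); [ring | rewrite hP; ring].
have nS : S != 0 -> 16 * p0 - p2 != 0.
  apply: contra_neq => e0; have : k * (16 * p0 - p2) = 16 * S.
    by transitivity (16 * (k * p0) - k * p2); [ring | rewrite -hS -hP; ring].
  by rewrite e0 mulr0 => /esym /eqP; rewrite mulf_eq0 pnatr_eq0 /= => /eqP.
have n2 : (2 : K) != 0 by rewrite pnatr_eq0.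
have [a230|a230] := eqVneq a23 0; last first.
  (* [e], [f], [g] kill [a12], [a13], [a03], and [d = a23^-1] makes the last entry 1; [b] remains to
     normalize [a01] or [a02]. *)
  pose e := a12 / (2 * a23); pose f b := - (b * a13) / a23.
  pose g := - (a03 + e * a13) / a23; pose u := a02 + a12 ^+ 2 / (4 * a23).
  have SE : S = - (4 * a23 * u) by rewrite /S /u /std_det; field.
  have act b : b != 0 -> std_act true b e a23^-1 (f b) g (a01, a02, a03, a12, a13, a23)
      = (P / (a23 * b), u / (a23 * b ^+ 2), 0, 0, 0, 1).
    move=> b0; apply: params_ext; rewrite /P /u /f /g /e /pfaffian;
      by field; rewrite ?a230 ?b0.
  have [u0|u0] := eqVneq u 0.
    (* Here [S = 0], so nondegeneracy forces [P != 0], and [b] can make the entry [a01] equal to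
       1. *)
    have P0 : P != 0.
      by apply: contraNneq nz => P0; rewrite P0 SE u0 mulr0 oppr0 expr0n addr0.
    have b0 : P / a23 != 0 by rewrite mulf_neq0 ?invr_eq0.
    exists (P / a23), e, a23^-1, (f (P / a23)), g; rewrite b0 invr_eq0; split=> //.
    rewrite act // u0 mul0r (_ : P / (a23 * (P / a23)) = 1); first by rewrite inE eqxx.
    by field; rewrite a230 P0.
  have S0 : S != 0 by rewrite SE oppr_eq0 !mulf_neq0 ?pnatr_eq0.
  (* This makes the entry [a02] equal to 1; the square of [a01] is then [- 4 P^2 / S]. *)
  pose b := sqrtC (u / a23).
  have b2 : b ^+ 2 = u / a23 by rewrite sqrtCK.
  have b0 : b != 0 by rewrite sqrtC_eq0 mulf_neq0 ?invr_eq0.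
  exists b, e, a23^-1, (f b), g; rewrite invr_eq0; split=> //.
  rewrite act // b2 (_ : u / (a23 * (u / a23)) = 1); last by field; rewrite a230 u0.
  have : (P / (a23 * b)) ^+ 2 = - (4 * p2) / (16 * p0 - p2).
    rewrite expr_div_n exprMn b2.
    have -> : P ^+ 2 = S * p2 / (16 * p0 - p2) by rewrite -ratio mulfK // nS.
    by rewrite SE; field; rewrite a230 u0 nS.
  by case/sqrtC_cases => ->; rewrite !inE eqxx ?orbT.
have [a120|a120] := eqVneq a12 0; last first.
  have SE : S = - a12 ^+ 2 by rewrite /S /std_det a230; ring.
  have S0 : S != 0 by rewrite SE oppr_eq0 expf_neq0.
  (* [e] kills [a02], [g] kills [a01], and [d = b / a12] makes [a12] equal to 1; [P / a12] is left
     in place of [a03]. *)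
  pose e := - a02 / a12; pose g := (a01 + 2 * e * a03 + e ^+ 2 * a13) / a12.
  have act b : b != 0 -> std_act true b e (b / a12) 0 g (a01, a02, a03, a12, a13, a23)
      = (0, 0, P / a12, 1, b * a13, 0).
    move=> b0; apply: params_ext; rewrite a230 /P /g /e /pfaffian ?a230;
      by field; rewrite ?a120 ?b0.
  have H : (P / a12) ^+ 2 = - p2 / (16 * p0 - p2).
    rewrite expr_div_n.
    have -> : P ^+ 2 = S * p2 / (16 * p0 - p2) by rewrite -ratio mulfK // nS.
    by rewrite SE; field; rewrite a120 nS.
  have [a130|a130] := eqVneq a13 0.
    exists 1, e, (1 / a12), 0, g; rewrite oner_neq0 mulf_neq0 ?oner_neq0 ?invr_eq0 //.
    split=> //; rewrite act ?oner_neq0 // a130 mulr0.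
    by case/sqrtC_cases: H => ->; rewrite !inE eqxx ?orbT.
  exists a13^-1, e, (a13^-1 / a12), 0, g.
  rewrite mulf_neq0 ?invr_eq0 //; split=> //; rewrite act ?invr_eq0 // mulVf //.
  by case/sqrtC_cases: H => ->; rewrite !inE eqxx ?orbT.
(* Here [S = 0] and [P = - a02 a13] is nonzero, which leaves a single normal form. *)
have PE : P = - (a02 * a13) by rewrite /P /pfaffian a230 a120; ring.
have SE : S = 0 by rewrite /S /std_det a230 a120; ring.
have [a020 a130] : a02 != 0 /\ a13 != 0.
  apply/andP; rewrite -negb_or -mulf_eq0; apply: contraNneq nz => h.
  by rewrite SE PE h; apply/eqP; ring.
pose e := - a03 / a13; pose b := a13^-1.
exists b, e, (b ^+ 2 / a02),
  (- (b * a01 + 2 * b * e * a03 + b * e ^+ 2 * a13) / a02), 0.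
have b0 : b != 0 by rewrite invr_eq0.
split=> //; first by rewrite mulf_neq0 ?expf_neq0 ?invr_eq0.
rewrite (_ : std_act _ _ _ _ _ _ _ = (0, 1, 0, 0, 1, 0)).
  by rewrite !inE eqxx !orbT.
by apply: params_ext; rewrite ?a230 ?a120 /e /b; field; rewrite ?a130 ?a020.
Qed.

End NormalForms.

(** * From the determinant to normal forms of congruences *)

Section ConicCongruences.
Variable K : numClosedFieldType.

(** The determinant at [t = 0] and [t = -1], and also at [t = 1] for two points, gives the
    invariants of [a] in terms of [p] and [k]. *)
Lemma normal_forms (dbl : bool) (p : K -> K) : exists N : seq (params K),
  forall a k, mx_of_params dbl a \in unitmx ->
    (forall t, \det (mx_of_params dbl a + t *: (mx_of_params dbl a)^T) = k * p t) ->
  exists b e d f g, [/\ b != 0, d != 0, ~~ dbl -> f = 0 &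
    std_act dbl b e d f g a \in N].
Proof.
case: dbl.
  have [N hN] := normal_forms_double (p 0) (p (-1)); exists N.
  move=> [[[[[a01 a02] a03] a12] a13] a23] k.
  rewrite unitmxE unitfE => nz hp.
  have h0 := hp 0; have h1 := hp (-1).
  pose M := std_mx true a01 a02 a03 a12 a13 a23.
  move: nz h0 h1; rewrite -[X in \det X != 0]addr0.
  rewrite -[X in \det (_ + X) != 0](scale0r M^T).
  rewrite /= !det_std_mx => nz h0 h1.
  have [||| b [e [d [f [g [b0 d0 h]]]]]] := hN a01 a02 a03 a12 a13 a23 k.
  - by apply: contraNneq nz => e; apply/eqP; apply: etrans e => /=; ring.
  - by rewrite -h0 /=; ring.
  - by rewrite -h1 /=; ring.
  by exists b, e, d, f, g.
(* At [t = 1] the determinant is 16, which fixes [k]; then [w] is a square root of [P^2], and [S] is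
   the value of [std_det]. *)
pose w := sqrtC (p (-1) / p 1); pose S := 16 * p 0 / p 1 - 1 - p (-1) / p 1.
have [N hN] := normal_forms_split ((- S / 2 + w) / 2) ((- S / 2 - w) / 2).
(* The Pfaffian is known up to sign, and a change of sign exchanges the two discriminants. *)
have [N' hN'] := normal_forms_split ((- S / 2 - w) / 2) ((- S / 2 + w) / 2).
exists (N ++ N') => -[[[[[a01 a02] a03] a12] a13] a23] k _ hp.
have h0 := hp 0; have h1 := hp 1; have h2 := hp (-1).
move: h0 h1 h2; rewrite /= !det_std_mx.
set T := std_det _ _ _ _ _ _ _; set P := pfaffian _ _ _ _ _ _ => h0 h1 h2.
have {}h1 : 16 = k * p 1 by rewrite -h1 /=; ring.
have {}h2 : 16 * P ^+ 2 = k * p (-1) by rewrite -h2 /=; ring.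
have {}h0 : 1 + T + P ^+ 2 = k * p 0 by rewrite -h0 /=; ring.
have n16 : (16 : K) != 0 by rewrite pnatr_eq0.
have [k0 p10] : k != 0 /\ p 1 != 0 by apply/andP; rewrite -negb_or -mulf_eq0 -h1.
have wP : P ^+ 2 = p (-1) / p 1.
  apply: (mulfI n16); rewrite h2 h1; by field.
have ST : T = S.
  rewrite /S -wP (_ : 16 * p 0 / p 1 = k * p 0); last by rewrite h1; field.
  by rewrite -h0; ring.
(* The two discriminants have sum [- T / 2] and difference [P]. *)
have e1 : ((a03 + a12) / 2) ^+ 2 - a02 * a13 = (- T / 2 + P) / 2.
  by rewrite /T /P /std_det /pfaffian; field.
have e2 : ((a03 - a12) / 2) ^+ 2 - a01 * a23 = (- T / 2 - P) / 2.
  by rewrite /T /P /std_det /pfaffian; field.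
have [P1|P1] := sqrtC_cases wP; rewrite ST P1 in e1 e2.
  have [b [e [d [g [b0 d0 h]]]]] := hN _ _ _ _ _ _ e1 e2.
  by exists b, e, d, 0, g; rewrite mem_cat h.
rewrite opprK in e2.
have [b [e [d [g [b0 d0 h]]]]] := hN' _ _ _ _ _ _ e1 e2.
by exists b, e, d, 0, g; rewrite mem_cat h orbT.
Qed.

Variables (V : vectType K) (L : {vspace V}) (c : bil (subvs_of L)) (dbl : bool).
Variables x y z : dual V.
Local Notation W0 := (conics_through c).
Local Notation W := (subvs_of W0).
Variables (X : 'I_4 -> W).
Hypothesis XE : forall i, vsval (X i) = nth 0 [:: sprod z z; sprod x z; sprod y z;
                     sprod x (if dbl then x else y)] i.

(** Justifies the formulas of [std_act]: the substitution acts linearly on the basic conics and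
    scales the relation [Q] by [b d] or [b^2]. *)
Lemma matrix_map_act (b e d f g : K) (alpha : 'End(V)) a u v w :
  b != 0 -> d != 0 -> (~~ dbl -> f = 0) ->
  (forall u, [/\ x (alpha u) = b * x u + e * z u,
    y (alpha u) = d * y u + f * x u + g * z u & z (alpha u) = z u]) ->
  vsval (matrix_map X (mx_of_params dbl a) (alpha u)) (alpha v) (alpha w)
  = b * (if dbl then b else d) *
    vsval (matrix_map X (mx_of_params dbl (std_act dbl b e d f g a)) u) v w.
Proof.
move=> b0 d0 f0 ha; rewrite !val_matrix_map.
case: a => [[[[[a01 a02] a03] a12] a13] a23].
pose m i := nth 0 [:: sprod z z; sprod x z; sprod y z;
                     sprod x (if dbl then x else y)] i.
(* The action on the basis; the last entry expands [(b x + e z)^2] or [(b x + e z) (d y + g z)]. *)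
pose h (t : nat -> K) := nth 0 [:: t 0; b * t 1 + e * t 0;
  d * t 2 + f * t 1 + g * t 0;
  if dbl then b ^+ 2 * t 3 + 2 * b * e * t 1 + e ^+ 2 * t 0
  else b * d * t 3 + b * g * t 1 + d * e * t 2 + e * g * t 0 ].
have mE (i : 'I_4) u' v' : m i (alpha u') (alpha v') = h (fun j => m j u' v') i.
  have [xu yu zu] := ha u'; have [xv yv zv] := ha v'.
  rewrite /m /h; case: i => -[|[|[|[|i]]]] //= _;
    rewrite ?sprodE ?xu ?yu ?zu ?xv ?yv ?zv //.
  - by ring.
  - by ring.
  case: (dbl) f0 => f0 /=; rewrite ?xu ?yu ?xv ?yv; first by ring.
  by rewrite f0 //; ring.
pose A j : K := m j v w; pose C j : K := m j u u.
transitivity (\sum_(i < 4) \sum_(j < 4)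
   mx_of_params dbl (a01, a02, a03, a12, a13, a23) i j
   * h A i * h C j).
  by apply: eq_bigr => i _; apply: eq_bigr => j _; rewrite !XE !mE.
transitivity (b * (if dbl then b else d) * \sum_(i < 4) \sum_(j < 4)
   mx_of_params dbl (std_act dbl b e d f g (a01, a02, a03, a12, a13, a23)) i j
   * A i * C j); last first.
  by congr (_ * _); apply: eq_bigr => i _; apply: eq_bigr => j _; rewrite !XE.
(* [A] and [C] become arbitrary: the identity is polynomial in the values of the basis. *)
move: A C => A C.
have mxE' a' (i j : 'I_4) : mx_of_params dbl a' i j =
    let: (a01, a02, a03, a12, a13, a23) := a' in
    std_entry dbl a01 a02 a03 a12 a13 a23 i j.
  by case: a' => [[[[[? ?] ?] ?] ?] ?]; rewrite /mx_of_params mxE.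
rewrite !big_ord_recl !big_ord0 !mxE' /= /bump /= /h /std_entry.
case: (dbl) f0 => f0 /=; last rewrite f0 //.
  by field.
by field; rewrite b0.
Qed.

End ConicCongruences.

(** * Finiteness of the fibres *)

Lemma finite_fibre_conics (K : numClosedFieldType) (V : vectType K)
    (L : {vspace V}) (c : bil (subvs_of L)) :
  \dim (fullv : {vspace V}) = 3%N -> \dim L = 2%N ->
  c \in sym2 (subvs_of L) -> c != 0 ->
  forall o, isom_quotient (conics_through c) o ->
    finite_set (fibre (conics_through c) (stabilizer c) o).
Proof.
move=> dV dL cs c0 _ [phi0 _ <-].
have [dbl [e0 [e1 [e2 [x [y [z ad]]]]]]] := adapted_frame_exists dV dL cs c0.
have [fr [k k0 cE]] := ad.
have [X [xi [coordX xiX XE]]] := conics_basis fr k0 cE.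
(* The polynomial is computed from [phi0], so the list [N] is chosen before any congruence. *)
have [N hN] := normal_forms dbl (fun t =>
  \det ((\matrix_(i, j) phi0 (X i) (X j) : 'M[K]_4)^T
        + t *: (\matrix_(i, j) phi0 (X i) (X j) : 'M[K]_4))).
apply: (@finite_fibre _ _ _ _ (@stabilizer_preserves _ _ _ c)
  (@stabilizer_comp _ _ _ c) (@stabilizer_inv _ _ _ c) _ X xi coordX
  (params K) (fun a => matrix_map X (mx_of_params dbl a)) N).
  move=> _ g [h h0 <-] g0; exists (h \o g)%VF.
    apply/lker0P => u v; rewrite !comp_lfunE => e.
    exact: (lker0P g0) _ _ ((lker0P h0) _ _ e).
  by apply/lfunP => u; apply/lfunP => v; rewrite !pullE !comp_lfunE.
move=> sigma phi hsigma hphi [g g0 gphi].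
have [B [hB inc Bn uB [kB hdet]]] :=
  congruence_matrix coordX xiX hsigma hphi (esym gphi).
have [lambda [a01 [a02 [a03 [a12 [a13 [a23 [l0 BE]]]]]]]] :
    exists lambda a01 a02 a03 a12 a13 a23, lambda != 0 /\
    B = lambda *: std_mx dbl a01 a02 a03 a12 a13 a23.
  (* Every triple of coordinates comes from a vector, so the identity on [V] holds on all of
     [K^3]. *)
  apply: incident_std_mx Bn => s t r X'.
  pose u := s *: e0 + t *: e1 + r *: e2.
  have [xu yu zu] : [/\ x u = s, y u = t & z u = r].
    have [x0 y0 z0] := frame0 fr; have [x1 y1 z1] := frame1 fr.
    have [x2 y2 z2] := frame2 fr.
    rewrite !linearD !linearZ /= x0 x1 x2 y0 y1 y2 z0 z1 z2.
    by rewrite -![_ *: _]/(_ * _) !mulr0 !mulr1 !addr0 !add0r.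
  have XE' (i : 'I_4) : vsval (X i) u u = X' i.
    rewrite XE /X'; case: i => -[|[|[|[|i]]]] //= _; rewrite sprodE ?xu ?yu ?zu //.
    by case: (dbl); rewrite ?xu ?yu.
  rewrite -[RHS](inc u); apply: eq_bigr => i _; apply: eq_bigr => j _.
  by rewrite !XE'.
pose a : params K := (a01, a02, a03, a12, a13, a23).
have {}BE : B = lambda *: mx_of_params dbl a by [].
have ua : mx_of_params dbl a \in unitmx.
  by move: uB; rewrite BE unitmxZ // unitfE.
(* Dividing [B] by [lambda] divides its determinant of order 4 by [lambda ^+ 4]. *)
have [t|b [e [d [f [g' [b0 d0 f0 nN]]]]]] := hN a (kB / lambda ^+ 4) ua.
  have e : lambda *: (mx_of_params dbl a + t *: (mx_of_params dbl a)^T) = B + t *: B^T.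
    by rewrite BE [in RHS]linearZ /= scalerDr !scalerA [t * _]mulrC.
  apply: (mulfI (expf_neq0 4 l0)); rewrite -detZ e hdet.
  by field.
have [alpha halpha aE] := triangular_stabilizer ad e g' b0 d0 f0.
exists (std_act dbl b e d f g' a) => //; exists alpha => //.
have s0 : b * (if dbl then b else d) != 0 by rewrite mulf_neq0 //; case: (dbl).
have pa := stabilizer_preserves halpha.
(* The two lifts agree up to the nonzero scalar [lambda b d] or [lambda b^2]. *)
apply: (eq_induced_by (mulf_neq0 l0 s0)) (induced_by_act pa hB) => u.
rewrite BE matrix_mapZ linearZ -scalerA; congr (_ *: _).
apply: val_inj; rewrite val_conic_act //; apply/lfunP => v; apply/lfunP => w.
rewrite pullE linearZ !scale_lfunE.
exact: (matrix_map_act XE a u v w b0 d0 f0 aE).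
Qed.

Theorem mainTheorem4 (R : realType) (V : vectType R[i]) (L : {vspace V})
    (c : bil (subvs_of L)) :
  \dim (fullv : {vspace V}) = 3%N ->
  \dim L = 2%N ->
  c \in sym2 (subvs_of L) ->
  c != 0 ->
  forall o, isom_quotient (conics_through c) o ->
    finite_set (fibre (conics_through c) (stabilizer c) o).
Proof. exact: finite_fibre_conics. Qed.
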